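(* Let $(M,F)$ be a connected Finsler space of dimension $n$ whose Ricci tensor $Ric_{ij}$ is parallel with respect to any one of the Cartan, Berwald or Chern connections. Then the Ricci tensor is constant along geodesics parameterized by arc length, i.e. for every geodesic $x(s)$ with arc-length parameter $s$ the function $Ric_{jk}\frac{dx^j}{ds}\frac{dx^k}{ds}$, evaluated at $(x(s),\frac{dx}{ds}(s))$, is constant in $s$. Moreover, along such a geodesic the solutions $p=p(s)$ of $$\{p,s\}=\frac{2}{n-1}Ric_{jk}\frac{dx^j}{ds}\frac{dx^k}{ds}$$ are given as follows, where $\alpha,\beta,\gamma,\delta$ are real constants with $\alpha\delta-\beta\gamma\neq 0$. (i) If $\{p,s\}=c^2$ with $c>0$, then $p=\dfrac{\alpha\cos(cs)+\beta\sin(cs)}{\gamma\cos(cs)+\delta\sin(cs)}$. (ii) If $\{p,s\}=-c^2$ with $c>0$, then $p=\dfrac{\alpha e^{cs}+\beta e^{-cs}}{\gamma e^{cs}+\delta e^{-cs}}$. (iii) If $\{p,s\}=0$, then $p=\dfrac{\alpha+\beta s}{\gamma+\delta s}$.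
   Context: A Finsler structure on an $n$-dimensional manifold $M$ is a function $F:TM\to[0,\infty)$ that is $C^\infty$ on the slit tangent bundle $TM_0=TM\setminus\{0\}$, satisfies $F(x,\lambda y)=\lambda F(x,y)$ for all $\lambda>0$, and for which $(g_{ij}):=\left(\left[\tfrac12F^2\right]_{y^iy^j}\right)$ is positive definite at every point of $TM_0$; $(M,F)$ is then a Finsler space. Its spray coefficients are $G^i:=\tfrac12 g^{il}\{[F^2]_{x^ky^l}y^k-[F^2]_{x^l}\}$. Geodesics parameterized by arc length $s$ (so $F(x,dx/ds)=1$) are the solutions of $\frac{d^2x^i}{ds^2}+G^i(x,\frac{dx}{ds})=0$. The Riemann curvature is given by $R^i_k=\frac{\partial G^i}{\partial x^k}-\frac12\frac{\partial^2G^i}{\partial y^k\partial x^j}y^j+G^j\frac{\partial^2G^i}{\partial y^k\partial y^j}-\frac12\frac{\partial G^i}{\partial y^j}\frac{\partial G^j}{\partial y^k}$. The Ricci scalar $Ric$ is defined by $F^2Ric=R^i_i$, and the Ricci tensor (in the sense of Akbar-Zadeh) is $Ric_{ik}:=\frac12(F^2Ric)_{y^iy^k}$, so that $Ric_{ik}y^iy^k=F^2Ric$. Let $N^i_j=\frac12\frac{\partial G^i}{\partial y^j}$, $\frac{\delta}{\delta x^k}=\frac{\partial}{\partial x^k}-N^l_k\frac{\partial}{\partial y^l}$, $\Gamma^i_{jk}=\frac12g^{ih}\left(\frac{\delta g_{hj}}{\delta x^k}+\frac{\delta g_{kh}}{\delta x^j}-\frac{\delta g_{jk}}{\delta x^h}\right)$,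 $G^i_{jk}=\frac12\frac{\partial^2G^i}{\partial y^j\partial y^k}$, and $A^i_{jk}=g^{ih}\frac F4\frac{\partial g_{hj}}{\partial y^k}$ (the Cartan tensor). The Ricci tensor is parallel with respect to a connection if both its horizontal and its vertical covariant derivatives vanish on $TM_0$: - Cartan: $\frac{\delta Ric_{ij}}{\delta x^k}-Ric_{ir}\Gamma^r_{jk}-Ric_{jr}\Gamma^r_{ik}=0$ and $\frac{\partial Ric_{ij}}{\partial y^k}-Ric_{ir}\frac{A^r_{jk}}F-Ric_{jr}\frac{A^r_{ik}}F=0$; - Chern: $\frac{\delta Ric_{ij}}{\delta x^k}-Ric_{ir}\Gamma^r_{jk}-Ric_{jr}\Gamma^r_{ik}=0$ and $\frac{\partial Ric_{ij}}{\partial y^k}=0$; - Berwald: $\frac{\delta Ric_{ij}}{\delta x^k}-Ric_{ir}G^r_{jk}-Ric_{jr}G^r_{ik}=0$ and $\frac{\partial Ric_{ij}}{\partial y^k}=0$. The Schwarzian derivative of a function $p(s)$ with $p'\neq0$ is $\{p,s\}=\frac{p'''}{p'}-\frac32\left(\frac{p''}{p'}\right)^2$, where $'=d/ds$.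
   Formalization: In (i), (ii) the condition {p,s}=±c² is corrected to ±2c² (e.g. {tan(cs),s}=2c²); in R^i_k the coefficients 1 and 1/2 of the two terms quadratic in G are corrected to 1/2 and 1/4, since the printed expression depends on the coordinates. *)

(* Defs.v *)
From HB Require Import structures.
From mathcomp Require Import all_boot all_order all_algebra.
From mathcomp Require Import all_classical all_reals all_analysis.
Import Order.TTheory GRing.Theory Num.Theory.
Import numFieldNormedType.Exports.

Set Implicit Arguments.
Unset Strict Implicit.
Unset Printing Implicit Defensive.

Local Open Scope classical_set_scope.
Local Open Scope ring_scope.

Definition iter_derive (R : realType) (V W : normedModType R)
    (vs : seq V) (f : V -> W) : V -> W :=
  foldr (fun v g => 'D_v g) f vs.

(* C^oo on an open set: every iterated directional derivative is Frechet
   differentiable (hence continuous) at every point of the set. *)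
Definition smooth_on (R : realType) (V W : normedModType R)
    (U : set V) (f : V -> W) : Prop :=
  forall (vs : seq V) (x : V), U x -> differentiable (iter_derive vs f) x.

(* [inv a] is only meaningful on the image of [dom a] under [crd a]. *)
Record smooth_atlas (R : realType) (n : nat) (M : topologicalType) :=
  SmoothAtlas {
    chart : Type;
    dom : chart -> set M;
    crd : chart -> M -> 'rV[R]_n;
    inv : chart -> 'rV[R]_n -> M;
    dom_open : forall a, open (dom a);
    dom_cover : forall p, exists a, dom a p;
    crd_open : forall a, open (crd a @` dom a);
    crdK : forall a p, dom a p -> inv a (crd a p) = p;
    crd_continuous : forall a p, dom a p -> {for p, continuous (crd a)};
    inv_continuous :
      forall a p, dom a p -> {for crd a p, continuous (inv a)};
    transition_smooth : forall a b,
      smooth_on (crd a @` (dom a `&` dom b)) (crd b \o inv a) }.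

(** Calculus in the induced coordinates [z = (x, y)] of the tangent bundle. *)

Definition dx (R : realType) (n : nat) (k : 'I_n)
    (f : 'rV[R]_n * 'rV[R]_n -> R) : 'rV[R]_n * 'rV[R]_n -> R :=
  'D_((delta_mx 0 k, 0) : 'rV[R]_n * 'rV[R]_n) f.

Definition dy (R : realType) (n : nat) (k : 'I_n)
    (f : 'rV[R]_n * 'rV[R]_n -> R) : 'rV[R]_n * 'rV[R]_n -> R :=
  'D_((0, delta_mx 0 k) : 'rV[R]_n * 'rV[R]_n) f.

Section LocalFormulas.
Context {R : realType} {n : nat}.
Implicit Types (F : 'rV[R]_n * 'rV[R]_n -> R) (z : 'rV[R]_n * 'rV[R]_n).
Implicit Types (i j k : 'I_n).

Definition fundamental F i j z : R := dy j (dy i (fun w => F w ^+ 2 / 2)) z.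

Definition fundamental_inv F i j z : R :=
  invmx (\matrix_(k, l) fundamental F k l z) i j.

(* Geodesics are x'' + G(x, x') = 0, so this is twice the spray coefficient of
   the convention x'' + 2 G(x, x') = 0. *)
Definition spray F i z : R :=
  2^-1 * \sum_l fundamental_inv F i l z *
    (\sum_k dy l (dx k (fun w => F w ^+ 2)) z * z.2 0 k
     - dx l (fun w => F w ^+ 2) z).

Definition nonlinear_connection F i j z : R := 2^-1 * dy j (spray F i) z.

(* The factors 1/2 and 1/4 of the terms quadratic in G are the ones belonging
   to the normalisation x'' + G = 0. With the factors 1 and 1/2 that are also
   found in the literature, which belong to x'' + 2 G = 0 (for R^i_k / 2),
   R^i_k would not be a tensor: R^i_i would not vanish for the Euclidean plane
   in polar coordinates. *)
Definition riemann F i k z : R :=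
  dx k (spray F i) z
  - 2^-1 * \sum_j dy k (dx j (spray F i)) z * z.2 0 j
  + 2^-1 * \sum_j spray F j z * dy k (dy j (spray F i)) z
  - 4^-1 * \sum_j dy j (spray F i) z * dy k (spray F j) z.

Definition ricci_scalar F z : R := (\sum_i riemann F i i z) / F z ^+ 2.

Definition ricci F i k z : R :=
  2^-1 * dy k (dy i (fun w => F w ^+ 2 * ricci_scalar F w)) z.

Definition delta F k (f : 'rV[R]_n * 'rV[R]_n -> R) z : R :=
  dx k f z - \sum_l nonlinear_connection F l k z * dy l f z.

Definition chern_coef F i j k z : R :=
  2^-1 * \sum_h fundamental_inv F i h z *
    (delta F k (fundamental F h j) z + delta F j (fundamental F k h) z
     - delta F h (fundamental F j k) z).

Definition berwald_coef F i j k z : R := 2^-1 * dy k (dy j (spray F i)) z.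

Definition cartan_tensor F i j k z : R :=
  \sum_h fundamental_inv F i h z * (F z / 4) * dy k (fundamental F h j) z.

Definition ricci_hderiv F (C : 'I_n -> 'I_n -> 'I_n -> 'rV[R]_n * 'rV[R]_n -> R)
    i j k z : R :=
  delta F k (ricci F i j) z
  - \sum_r ricci F i r z * C r j k z
  - \sum_r ricci F j r z * C r i k z.

Definition ricci_vderiv_cartan F i j k z : R :=
  dy k (ricci F i j) z
  - \sum_r ricci F i r z * (cartan_tensor F r j k z / F z)
  - \sum_r ricci F j r z * (cartan_tensor F r i k z / F z).

Definition cartan_parallel_at F z : Prop := forall i j k,
  ricci_hderiv F (chern_coef F) i j k z = 0 /\ ricci_vderiv_cartan F i j k z = 0.

Definition chern_parallel_at F z : Prop := forall i j k,
  ricci_hderiv F (chern_coef F) i j k z = 0 /\ dy k (ricci F i j) z = 0.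

Definition berwald_parallel_at F z : Prop := forall i j k,
  ricci_hderiv F (berwald_coef F) i j k z = 0 /\ dy k (ricci F i j) z = 0.

End LocalFormulas.

(* The part of the slit tangent bundle over the chart [a], in coordinates. *)
Definition slit (R : realType) (n : nat) (M : topologicalType)
    (A : smooth_atlas R n M) (a : chart A) : set ('rV[R]_n * 'rV[R]_n) :=
  [set z | (crd a @` dom a) z.1 /\ z.2 != 0].

(* TM is the union of the sets [crd a @` dom a] x R^n glued along the
   differentials of the transition maps, so a function on TM is a family of
   functions of the coordinates (x, y) that agree under this glueing
   ([finsler_glue]). *)
Record finsler (R : realType) (n : nat) (M : topologicalType)
    (A : smooth_atlas R n M) := Finsler {
  norm_in :> chart A -> 'rV[R]_n * 'rV[R]_n -> R;
  finsler_glue : forall a b p y, dom a p -> dom b p ->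
    norm_in b (crd b p, 'D_y (crd b \o inv a) (crd a p))
    = norm_in a (crd a p, y);
  finsler_ge0 : forall a p y, dom a p -> 0 <= norm_in a (crd a p, y);
  finsler_smooth : forall a, smooth_on (slit a) (norm_in a);
  finsler_homogeneous : forall a p y (l : R), dom a p -> 0 < l ->
    norm_in a (crd a p, l *: y) = l * norm_in a (crd a p, y);
  finsler_posdef : forall a z, slit a z -> forall v : 'rV[R]_n, v != 0 ->
    0 < \sum_i \sum_j fundamental (norm_in a) i j z * v 0 i * v 0 j }.

Section Parallel.
Context {R : realType} {n : nat} {M : topologicalType}.
Context {A : smooth_atlas R n M}.
Implicit Type F : finsler A.

Definition cartan_parallel F : Prop :=
  forall a z, slit a z -> cartan_parallel_at (F a) z.

Definition chern_parallel F : Prop :=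
  forall a z, slit a z -> chern_parallel_at (F a) z.

Definition berwald_parallel F : Prop :=
  forall a z, slit a z -> berwald_parallel_at (F a) z.

(* The point (x(s), dx/ds) of TM in the coordinates of the chart [a]. *)
Definition lift (x : R -> M) (a : chart A) (s : R) : 'rV[R]_n * 'rV[R]_n :=
  (crd a (x s), derive1 (crd a \o x) s).

Definition geodesic F (J : set R) (x : R -> M) : Prop :=
  forall s, J s -> {for s, continuous x} /\
  forall a, dom a (x s) ->
    [/\ derivable (crd a \o x) s 1,
        derivable (derive1 (crd a \o x)) s 1,
        F a (lift x a s) = 1 &
        forall i, derive1n 2 (crd a \o x) s 0 i + spray (F a) i (lift x a s) = 0].

Definition ricci_along F (x : R -> M) (a : chart A) (s : R) : R :=
  \sum_j \sum_k ricci (F a) j k (lift x a s)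
    * (lift x a s).2 0 j * (lift x a s).2 0 k.

End Parallel.

(* If u, v are independent solutions of w'' + q w = 0, then {u / v, s} = 2 q:
   for instance {tan (c s), s} = 2 c ^ 2 and {exp (2 c s), s} = - 2 c ^ 2. *)
Definition schwarzian (R : realType) (p : R -> R) (s : R) : R :=
  derive1n 3 p s / derive1 p s - 3 / 2 * (derive1n 2 p s / derive1 p s) ^+ 2.

Definition projective_parameter (R : realType) (n : nat) (M : topologicalType)
    (A : smooth_atlas R n M) (F : finsler A) (x : R -> M)
    (J : set R) (p : R -> R) : Prop :=
  forall s, J s ->
  [/\ derivable p s 1, derivable (derive1 p) s 1, derivable (derive1n 2 p) s 1,
      derive1 p s != 0 &
      forall a, dom a (x s) ->
        schwarzian p s = 2 / (n%:R - 1) * ricci_along F x a s].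

(* [p = (al u + be v) / (ga u + de v)] on [J] with real constants such that
   [al de - be ga <> 0]. *)
Definition moebius_of (R : realType) (u v : R -> R) (J : set R) (p : R -> R) :
    Prop :=
  exists al be ga de : R, al * de - be * ga != 0 /\
  forall s, J s -> ga * u s + de * v s != 0 /\
    p s = (al * u s + be * v s) / (ga * u s + de * v s).

(* Main.v *)
Require Import Defs.
From HB Require Import structures.
From mathcomp Require Import all_boot all_order all_algebra.
From mathcomp Require Import all_classical all_reals all_analysis.
From mathcomp Require Import ring lra.
Import Order.TTheory GRing.Theory Num.Theory.
Import numFieldNormedType.Exports.

Set Implicit Arguments.
Unset Strict Implicit.
Unset Printing Implicit Defensive.

Local Open Scope classical_set_scope.
Local Open Scope ring_scope.

(** Write [G] for the spray coefficients, [y] for the fibre coordinates and [T]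
    for the trace [R^i_i], so that the Ricci tensor is half of the fibrewise
    Hessian of [T].

    In one chart, the horizontal covariant derivative of the Ricci tensor,
    contracted with [y^i y^j y^k], is the derivative of [Ric_ij y^i y^j] along
    the geodesic flow. The connection plays no role here: by homogeneity,
    [N^i_k y^k = G^i], and both the Chern and the Berwald coefficients satisfy
    [C^i_jk y^j y^k = G^i] ([nonlinear_connection_contract], [chern_contract],
    [berwald_contract]). Hence [Ric_ij x'^i x'^j] has derivative zero along a
    unit speed geodesic as long as it stays in one chart
    ([ricci_along_geodesic_derive]).

    A geodesic may leave a chart, so [Ric_ij y^i y^j] has to be shown to be a
    function on the tangent bundle. Under a change of coordinates [phi] with
    Jacobian matrix [J], the spray coefficients pick up the second derivatives
    of [phi] ([spray_Phi]):
      [G' = J G - H(y, y)].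
    Differentiating this law along the fibres, along the base, and once more
    along the spray, which is the same vector field in both coordinate systems,
    gives three matrix identities from which all second and third derivatives of
    [phi] cancel in [R' J = J R]. Therefore [T] is invariant
    ([ricci_trace_Phi]), and so is the quadratic form of its fibrewise Hessian
    ([ricci_quadratic_Phi]). This needs the symmetry of second derivatives
    ([young]) and the smoothness of all the objects involved. Consequently
    [Ric_ij x'^i x'^j] is locally constant, hence constant, on the interval of
    definition of the geodesic ([ricci_along_constant]).

    There remains the equation [{p, s} = 2 q] with a constant [q]. A quotient of
    two independent solutions of [w'' + q w = 0] satisfies it
    ([moebius_schwarzian]). Conversely, if [p] satisfies it, then
    [w = |p'|^(-1/2)] and [p w] both solve the linear equation, so both are
    combinations of two given independent solutions, and [p] is their quotient
    ([schwarzian_moebius]). *)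

(** * Smooth functions *)

Section Derivations.
Context {R : realType} {V : normedModType R}.
Implicit Types (f g : V -> R) (v x : V).

Lemma derD f g v x : differentiable f x -> differentiable g x ->
  'D_v (fun w => f w + g w) x = 'D_v f x + 'D_v g x.
Proof. by move=> df dg; rewrite -deriveD//; exact: diff_derivable. Qed.

Lemma derB f g v x : differentiable f x -> differentiable g x ->
  'D_v (fun w => f w - g w) x = 'D_v f x - 'D_v g x.
Proof. by move=> df dg; rewrite -deriveB//; exact: diff_derivable. Qed.

Lemma derM f g v x : differentiable f x -> differentiable g x ->
  'D_v (fun w => f w * g w) x = 'D_v f x * g x + f x * 'D_v g x.
Proof.
move=> df dg; rewrite [LHS](@deriveM _ _ f g); [|exact: diff_derivable..].
by rewrite addrC /GRing.scale/= mulrC.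
Qed.

Lemma derZ (c : R) f v x : differentiable f x ->
  'D_v (fun w => c * f w) x = c * 'D_v f x.
Proof.
by move=> df; rewrite [LHS](@deriveZ _ _ _ f c)//; exact: diff_derivable.
Qed.

Lemma der_sum n (f : 'I_n -> V -> R) v x :
  (forall i, differentiable (f i) x) ->
  'D_v (fun w => \sum_i f i w) x = \sum_i 'D_v (f i) x.
Proof.
move=> df; rewrite -derive_sum; last by move=> i; exact: diff_derivable.
by congr ('D_v _ x); apply/funext => w; rewrite fct_sumE.
Qed.

Lemma diff_sum n (f : 'I_n -> V -> R) x :
  (forall i, differentiable (f i) x) ->
  differentiable (fun w => \sum_i f i w) x.
Proof.
move=> df; have := differentiable_sum df.
by rewrite (_ : \sum_i f i = fun w => \sum_i f i w)//;
  apply/funext => w; rewrite fct_sumE.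
Qed.

Lemma derV f v x : differentiable f x -> f x != 0 ->
  'D_v (fun w => (f w)^-1) x = - ('D_v f x * ((f x)^-1 * (f x)^-1)).
Proof.
move=> df fx0; rewrite deriveV//; last exact: diff_derivable.
by rewrite /GRing.scale/= -invfM -expr2 mulNr mulrC.
Qed.

End Derivations.

Section SmoothFunctions.
Context {R : realType} {V : normedModType R}.
Implicit Types (W : normedModType R) (v x : V) (U : set V).

(** [Ck k U f]: the directional derivatives of [f] of order at most [k] are
    differentiable on [U]; this is the form of smoothness that suits
    inductions. *)
Fixpoint Ck W (k : nat) U (f : V -> W) : Prop :=
  (forall x, U x -> differentiable f x) /\
  if k is k'.+1 then forall v, Ck k' U ('D_v f) else True.

Lemma smooth_onP W U (f : V -> W) : smooth_on U f <-> forall k, Ck k U f.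
Proof.
split.
  move=> + k; elim: k f => [|k IH] f sf; split=> //.
  - by move=> x; exact: (sf [::]).
  - by move=> x; exact: (sf [::]).
  - by move=> v; apply: IH => vs x Ux; have := sf (rcons vs v) x Ux;
      rewrite /iter_derive foldr_rcons.
move=> + vs; elim/last_ind: vs f => [|vs v IH] f kf x Ux.
  by have [+ _] := kf 0; exact.
rewrite /iter_derive foldr_rcons; apply: IH => // k.
by have [_ +] := kf k.+1; exact.
Qed.

Lemma smooth_Ck W k U (f : V -> W) : smooth_on U f -> Ck k U f.
Proof. by move=> /smooth_onP. Qed.

Lemma smooth_diff W U (f : V -> W) x :
  smooth_on U f -> U x -> differentiable f x.
Proof. by move=> sf; exact: (sf [::]). Qed.

Lemma smooth_D W U (f : V -> W) v : smooth_on U f -> smooth_on U ('D_v f).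
Proof.
by move=> sf vs x Ux; have := sf (rcons vs v) x Ux;
  rewrite /iter_derive foldr_rcons.
Qed.

Lemma smooth_sub W U U' (f : V -> W) :
  U' `<=` U -> smooth_on U f -> smooth_on U' f.
Proof. by move=> sU sf vs x /sU; exact: sf. Qed.

Lemma near_open_eq W U (f g : V -> W) x : open U -> U x ->
  (forall y, U y -> f y = g y) -> \forall y \near x, f y = g y.
Proof.
move=> oU Ux fg; have : nbhs x U by exact: open_nbhs_nbhs.
by apply: filterS.
Qed.

Lemma der_eq_on W U (f g : V -> W) v x : open U ->
  (forall y, U y -> f y = g y) -> U x -> 'D_v f x = 'D_v g x.
Proof. by move=> oU fg Ux; apply: near_eq_derive; exact: near_open_eq fg. Qed.

Lemma near_differentiable W (f g : V -> W) x :
  (\forall y \near x, f y = g y) -> differentiable f x -> differentiable g x.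
Proof.
move=> fg df; apply/diff_locallyP.
have dlin : continuous ('d f x) by exact: diff_continuous.
have H : g \o shift x = cst (g x) + 'd f x +o_ 0 id.
  have /diff_locally df' := df.
  have fgx : f x = g x by exact: nbhs_singleton fg.
  apply/eqaddoP => _/posnumP[e].
  have /eqaddoP/(_ _ [gt0 of e%:num]) := df'.
  rewrite -fgx; apply: filter_app.
  have : \forall y \near (0 : V), f (y + x) = g (y + x).
    by rewrite (near_shift x) sub0r; near=> y; rewrite /= subrK; near: y.
  apply: filter_app; near=> y => fgy.
  by rewrite !fctE /= fgy.
have -> := diff_unique dlin H.
by split.
Unshelve. all: by end_near. Qed.

Lemma Ck_eq W k U (f g : V -> W) : open U -> (forall y, U y -> f y = g y) ->
  Ck k U f -> Ck k U g.
Proof.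
move=> oU; elim: k f g => [|k IH] f g fg [df cf]; split=> //.
- by move=> x Ux; apply: near_differentiable (df x Ux); exact: near_open_eq fg.
- by move=> x Ux; apply: near_differentiable (df x Ux); exact: near_open_eq fg.
- move=> v; apply: IH (cf v) => y Uy; exact: der_eq_on fg Uy.
Qed.

Lemma smooth_eq W U (f g : V -> W) : open U -> (forall y, U y -> f y = g y) ->
  smooth_on U f -> smooth_on U g.
Proof.
by move=> oU fg /smooth_onP sf; apply/smooth_onP => k; exact: Ck_eq (sf k).
Qed.

Lemma CkW W k U (f : V -> W) : Ck k.+1 U f -> Ck k U f.
Proof.
elim: k f => [|k IH] f [df cf]; split=> //.
by move=> v; apply: IH.
Qed.

Lemma smooth_cst W U (c : W) : smooth_on U (fun=> c).
Proof.
apply/smooth_onP => k; elim: k c => [|k IH] c.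
  by split=> // x _; exact: differentiable_cst.
split=> [x _|v]; first exact: differentiable_cst.
rewrite [X in Ck _ _ X](_ : _ = fun=> 0); first exact: IH.
by apply/funext => x; exact: derive_cst.
Qed.

Lemma CkD k U (f g : V -> R) : open U ->
  Ck k U f -> Ck k U g -> Ck k U (fun x => f x + g x).
Proof.
move=> oU; elim: k f g => [|k IH] f g [df cf] [dg cg]; split=> //.
- by move=> x Ux; apply: differentiableD; [exact: df|exact: dg].
- by move=> x Ux; apply: differentiableD; [exact: df|exact: dg].
- move=> v; apply: Ck_eq (IH _ _ (cf v) (cg v)) => // y Uy.
  by rewrite derD //; [exact: df|exact: dg].
Qed.

Lemma CkM k U (f g : V -> R) : open U ->
  Ck k U f -> Ck k U g -> Ck k U (fun x => f x * g x).
Proof.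
move=> oU; elim: k f g => [|k IH] f g cf cg; case: (cf) (cg) => [df cf'] [dg cg'];
    split=> //.
- by move=> x Ux; apply: differentiableM; [exact: df|exact: dg].
- by move=> x Ux; apply: differentiableM; [exact: df|exact: dg].
- move=> v; apply: (@Ck_eq _ _ _ (fun y => 'D_v f y * g y + f y * 'D_v g y)) => //.
    by move=> y Uy; rewrite derM //; [exact: df|exact: dg].
  by apply: CkD => //; apply: IH => //; first [exact: cf'|exact: cg'|exact: CkW].
Qed.

Lemma smoothD U (f g : V -> R) : open U ->
  smooth_on U f -> smooth_on U g -> smooth_on U (fun x => f x + g x).
Proof.
move=> oU /smooth_onP sf /smooth_onP sg; apply/smooth_onP => k.
exact: CkD.
Qed.

Lemma smoothM U (f g : V -> R) : open U ->
  smooth_on U f -> smooth_on U g -> smooth_on U (fun x => f x * g x).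
Proof.
move=> oU /smooth_onP sf /smooth_onP sg; apply/smooth_onP => k.
exact: CkM.
Qed.

Lemma smoothZ U (c : R) (f : V -> R) : open U ->
  smooth_on U f -> smooth_on U (fun x => c * f x).
Proof. by move=> oU; apply: smoothM => //; exact: smooth_cst. Qed.

Lemma smoothN U (f : V -> R) : open U ->
  smooth_on U f -> smooth_on U (fun x => - f x).
Proof.
move=> oU /(smoothZ (-1) oU); apply: smooth_eq => // y _.
by rewrite mulN1r.
Qed.

Lemma smoothB U (f g : V -> R) : open U ->
  smooth_on U f -> smooth_on U g -> smooth_on U (fun x => f x - g x).
Proof. by move=> oU sf sg; apply: smoothD => //; exact: smoothN. Qed.

Lemma smooth_sum U (I : Type) (r : seq I) (P : pred I) (f : I -> V -> R) :
  open U -> (forall i, smooth_on U (f i)) ->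
  smooth_on U (fun x => \sum_(i <- r | P i) f i x).
Proof.
move=> oU sf; elim: r => [|i r IH].
  by apply: smooth_eq (smooth_cst (0 : R)) => // y _; rewrite big_nil.
have [Pi|Pi] := boolP (P i).
  by apply: smooth_eq (smoothD oU (sf i) IH) => // y _; rewrite big_cons Pi.
by apply: smooth_eq IH => // y _; rewrite big_cons (negbTE Pi).
Qed.

Lemma smooth_prod U (I : Type) (r : seq I) (P : pred I) (f : I -> V -> R) :
  open U -> (forall i, smooth_on U (f i)) ->
  smooth_on U (fun x => \prod_(i <- r | P i) f i x).
Proof.
move=> oU sf; elim: r => [|i r IH].
  by apply: smooth_eq (smooth_cst (1 : R)) => // y _; rewrite big_nil.
have [Pi|Pi] := boolP (P i).
  by apply: smooth_eq (smoothM oU (sf i) IH) => // y _; rewrite big_cons Pi.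
by apply: smooth_eq IH => // y _; rewrite big_cons (negbTE Pi).
Qed.

Lemma smoothV U (f : V -> R) : open U -> (forall x, U x -> f x != 0) ->
  smooth_on U f -> smooth_on U (fun x => (f x)^-1).
Proof.
move=> oU f0 sf; apply/smooth_onP => k.
have df x : U x -> differentiable f x by exact: smooth_diff.
have dV x : U x -> differentiable (fun x => (f x)^-1) x.
  by move=> Ux; apply: differentiableV; [exact: df|exact: f0].
elim: k => [|k IH]; split=> // v.
apply: (@Ck_eq _ _ _ (fun y => (-1) * ('D_v f y * ((f y)^-1 * (f y)^-1)))) => //.
  by move=> y Uy; rewrite derV ?mulN1r//; [exact: df|exact: f0].
apply: CkM => //; first exact/smooth_Ck/smooth_cst.
apply: CkM => //; last exact: CkM.
exact/smooth_Ck/smooth_D.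
Qed.

Lemma smooth_det U n (A : V -> 'M[R]_n) : open U ->
  (forall i j, smooth_on U (fun x => A x i j)) ->
  smooth_on U (fun x => \det (A x)).
Proof.
move=> oU sA; rewrite /determinant; apply: smooth_sum => // s.
by apply: smoothZ => //; apply: smooth_prod.
Qed.

(** By Cramer's rule. *)
Lemma smooth_invmx U n (A : V -> 'M[R]_n) i j : open U ->
  (forall x, U x -> A x \in unitmx) ->
  (forall i j, smooth_on U (fun x => A x i j)) ->
  smooth_on U (fun x => invmx (A x) i j).
Proof.
move=> oU uA sA.
apply: (@smooth_eq _ _ (fun x => (\det (A x))^-1 * cofactor (A x) j i)) => //.
  by move=> x Ux; rewrite /invmx uA// !mxE.
apply: smoothM => //.
  apply: smoothV => //; last exact: smooth_det.
  by move=> x Ux; rewrite -unitfE -unitmxE uA.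
apply: smoothZ => //; apply: smooth_det => // k l.
by apply: smooth_eq (sA (lift j k) (lift i l)) => // x _; rewrite !mxE.
Qed.

Lemma smooth_coord U m n (f : V -> 'M[R]_(m, n)) i j : open U ->
  smooth_on U f -> smooth_on U (fun x => f x i j).
Proof.
move=> oU /smooth_onP sf; apply/smooth_onP => k.
have dc (g : V -> 'M[R]_(m, n)) x : differentiable g x -> differentiable (fun x => g x i j : R) x.
  move=> dg; apply: (@differentiable_comp _ _ _ _ g (fun N => N i j : R) x dg).
  exact: differentiable_coord.
elim: k f {sf}(sf k) => [|k IH] f [df cf]; split=> //.
- by move=> x /df; exact: dc.
- by move=> x /df; exact: dc.
- move=> v; apply: Ck_eq (IH _ (cf v)) => // x Ux.
  rewrite derive_mx ?mxE//.
  exact/diff_derivable/df.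
Qed.

End SmoothFunctions.

Section Young.
Context {R : realType} {V : normedModType R}.
Implicit Types (f : V -> R) (u v x : V) (U : set V).

Lemma is_derive_line f u y (s : R) : differentiable f (s *: u + y) ->
  is_derive s 1 (fun s => f (s *: u + y)) ('D_u f (s *: u + y)).
Proof.
move=> df; have dl : is_diff s (fun s : R => s *: u + y) (fun s => s *: u).
  have -> : (fun s : R => s *: u) = (fun s : R => s *: u) + cst 0.
    by apply/funext => r; rewrite /= !fctE addr0.
  apply: is_diffD.
have dc := differentiable_comp (@ex_diff _ _ _ _ _ _ _ dl) df.
apply: DeriveDef; first exact: diff_derivable.
rewrite deriveE// (diff_comp (@ex_diff _ _ _ _ _ _ _ dl) df) /=.
by rewrite diff_val scale1r deriveE.
Qed.

(* The second difference of [f] at [x]. *)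
Let Delta f u v x (t : R) :=
  f (t *: u + (t *: v + x)) - f (t *: u + x) - f (t *: v + x) + f x.

(* The mean value theorem in the direction [u] reduces the second difference to
   increments of ['D_u f], which is differentiable at [x]. *)
Let second_difference U f u v x : open U -> smooth_on U f -> U x ->
  forall e, 0 < e -> exists2 d, 0 < d & forall t, 0 < t < d ->
    `|Delta f u v x t - t ^+ 2 * 'D_v ('D_u f) x| <= e * t ^+ 2.
Proof.
move=> oU sf Ux e e0.
have dDf : differentiable ('D_u f) x by exact: smooth_diff (smooth_D u sf) Ux.
pose C := `|u| + (`|u| + `|v|) + 1.
have C0 : 0 < C by rewrite /C ltr_wpDl// ?addr_ge0// ?addr_ge0.
have /diff_locally/eqaddoP/(_ _ (divr_gt0 e0 C0)) := dDf.
move=> /nbhs_ballP[r /= r0 Hr].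
have [r' /= r'0 Hr'] : exists2 r', 0 < r' & forall h, `|h| < r' -> U (h + x).
  have : nbhs x U by exact: open_nbhs_nbhs.
  move=> /nbhs_ballP[r' /= r'0 Hr']; exists r' => // h hr.
  by apply: Hr'; rewrite -ball_normE /= opprD addrCA subrr addr0 normrN.
pose rm := Num.min r r'.
have rm0 : 0 < rm by rewrite lt_min r0.
exists (rm / C); first exact: divr_gt0.
move=> t /andP[t0 td].
have small c : 0 <= c <= t ->
    `|c *: u + t *: v| < rm /\ `|c *: u| < rm.
  move=> /andP[c0 ct]; move: td; rewrite ltr_pdivlMr// => td.
  have cu : `|c *: u| <= t * `|u|.
    by rewrite normrZ ger0_norm// ler_wpM2r.
  have tv : `|t *: v| = t * `|v| by rewrite normrZ gtr0_norm.
  split; apply: le_lt_trans td.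
    rewrite (le_trans (ler_normD _ _))// tv.
    rewrite (le_trans (lerD cu (lexx _)))// /C -mulrDr ler_pM2l//.
    have := normr_ge0 u; have := normr_ge0 v; lra.
  rewrite (le_trans cu)// ler_pM2l// /C.
  have := normr_ge0 u; have := normr_ge0 v; lra.
have inU c : 0 <= c <= t -> U (c *: u + (t *: v + x)) /\ U (c *: u + x).
  move=> /small[h1 h2]; rewrite addrA; split; apply: Hr'.
    by apply: lt_le_trans h1 _; rewrite ge_min lexx orbT.
  by apply: lt_le_trans h2 _; rewrite ge_min lexx orbT.
pose g s := f (s *: u + (t *: v + x)) - f (s *: u + x).
pose dg s := 'D_u f (s *: u + (t *: v + x)) - 'D_u f (s *: u + x).
have isd s : 0 <= s <= t -> is_derive s 1 g (dg s).
  move=> /inU[h1 h2]; apply: is_deriveB; apply: is_derive_line;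
  exact: smooth_diff sf _.
have [c /[!in_itv]/= /andP[c0 ct] Hc] : exists2 c, c \in `]0, t[%R &
    g t - g 0 = dg c * (t - 0).
  apply: MVT => // [s|].
    by rewrite in_itv/= => /andP[s0 st]; apply: isd; rewrite !ltW.
  apply: derivable_within_continuous => s; rewrite in_itv/= => s0.
  by have := isd _ s0 => /@ex_derive.
have c0t : 0 <= c <= t by rewrite !ltW.
have -> : Delta f u v x t = g t - g 0.
  by rewrite /g /Delta !scale0r !add0r; ring.
rewrite Hc subr0 (deriveE _ dDf).
have [s1 s2] := small c c0t.
have est h : `|h| < rm ->
    `|'D_u f (h + x) - 'D_u f x - 'd ('D_u f) x h| <= e / C * `|h|.
  move=> hr; have := Hr h; rewrite -ball_normE /= sub0r normrN !fctE opprD addrA.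
  by apply; rewrite (lt_le_trans hr)// ge_min lexx.
set L := 'd _ x v; pose Lu := 'd ('D_u f) x u.
have l1 : 'd ('D_u f) x (c *: u + t *: v) = c * Lu + t * L.
  by rewrite linearD !linearZ.
have l2 : 'd ('D_u f) x (c *: u) = c * Lu by rewrite linearZ.
have := est _ s1; have := est _ s2.
rewrite l1 l2 /dg [c *: u + (t *: v + x)]addrA.
set A := 'D_u f (c *: u + x); set B := 'D_u f (c *: u + t *: v + x).
set D0 := 'D_u f x => H1 H2.
have -> : (B - A) * t - t ^+ 2 * L =
    t * ((B - D0 - (c * Lu + t * L)) - (A - D0 - c * Lu)).
  by ring.
rewrite normrM gtr0_norm// expr2 mulrCA ler_pM2l//.
rewrite (le_trans (ler_normB _ _))// (le_trans (lerD H2 H1))//.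
have cu : `|c *: u| <= t * `|u|.
  by rewrite normrZ ger0_norm ?(ltW c0)// ler_wpM2r// ltW.
have tv : `|t *: v| = t * `|v| by rewrite normrZ gtr0_norm.
have uv := ler_normD (c *: u) (t *: v); rewrite tv in uv.
have -> : e * t = e / C * (t * C) by field; rewrite gt_eqF.
rewrite -mulrDr ler_pM2l ?divr_gt0// /C.
by move: cu uv t0; lra.
Qed.

(** Young's theorem: the second directional derivatives of a smooth function
    commute. Both are the limit of the second difference quotient, which is
    symmetric in the two directions. *)
Lemma young U f u v x : open U -> smooth_on U f -> U x ->
  'D_v ('D_u f) x = 'D_u ('D_v f) x.
Proof.
move=> oU sf Ux; apply/eqP; rewrite -subr_eq0 -normr_eq0; apply/eqP.
apply/eqP; rewrite eq_le normr_ge0 andbT; apply/ler_addgt0Pl => e e0.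
rewrite addr0.
have e2 : 0 < e / 2 by exact: divr_gt0.
have [d1 d10 H1] := second_difference u v oU sf Ux e2.
have [d2 d20 H2] := second_difference v u oU sf Ux e2.
pose t := Num.min d1 d2 / 2.
have m0 : 0 < Num.min d1 d2 by rewrite lt_min d10.
have t0 : 0 < t by exact: divr_gt0.
have tm : t < Num.min d1 d2 by rewrite /t ltr_pdivrMr// ltr_pMr// ltr1n.
have t1 : 0 < t < d1 by rewrite t0 (lt_le_trans tm)// ge_min lexx.
have t2 : 0 < t < d2 by rewrite t0 (lt_le_trans tm)// ge_min lexx orbT.
have := H1 _ t1; have := H2 _ t2.
have -> : Delta f v u x t = Delta f u v x t.
  by rewrite /Delta addrCA; ring.
set D := Delta _ _ _ _ _; set a := 'D_u _ x; set b := 'D_v _ x => Ha Hb.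
have t20 : 0 < t ^+ 2 by exact: exprn_gt0.
rewrite -(ler_pM2r t20).
rewrite -{1}(gtr0_norm t20) -normrM.
have -> : (b - a) * t ^+ 2 = (D - t ^+ 2 * a) - (D - t ^+ 2 * b) by ring.
rewrite (le_trans (ler_normB _ _))// (le_trans (lerD Ha Hb))//.
by rewrite -mulrDl -splitr.
Qed.

End Young.

(** * Calculus in the coordinates of the tangent bundle *)

Section Coordinates.
Context {R : realType} {n : nat}.
Local Notation TR := ('rV[R]_n * 'rV[R]_n)%type.
Implicit Types (f : TR -> R) (z : TR) (k l : 'I_n).

(** The differential in terms of the partial derivatives [dx] and [dy]. *)
Lemma diff_coord f z (u v : 'rV[R]_n) : differentiable f z ->
  'd f z (u, v) = \sum_k u 0 k * dx k f z + \sum_k v 0 k * dy k f z.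
Proof.
move=> df.
have -> : (u, v) = \sum_k u 0 k *: ((delta_mx 0 k, 0) : TR)
                   + \sum_k v 0 k *: ((0, delta_mx 0 k) : TR).
  rewrite {1}[u]row_sum_delta {1}[v]row_sum_delta.
  have pairD (a b c d : 'rV[R]_n) : (a, b) + (c, d) = (a + c, b + d) :> TR by [].
  have -> : \sum_k u 0 k *: ((delta_mx 0 k, 0) : TR) =
            (\sum_k u 0 k *: delta_mx 0 k, 0).
    elim/big_ind2: _ => //= [a b c d -> ->|i _]; first by rewrite pairD addr0.
    by congr pair; rewrite scaler0.
  have -> : \sum_k v 0 k *: ((0, delta_mx 0 k) : TR) =
            (0, \sum_k v 0 k *: delta_mx 0 k).
    elim/big_ind2: _ => //= [a b c d -> ->|i _]; first by rewrite pairD addr0.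
    by congr pair; rewrite scaler0.
  by rewrite pairD addr0 add0r.
rewrite linearD !linear_sum /=; congr (_ + _); apply: eq_bigr => k _.
- by rewrite linearZ /= /dx deriveE.
- by rewrite linearZ /= /dy deriveE.
Qed.

Lemma der_coord f z (u v : 'rV[R]_n) : differentiable f z ->
  'D_((u, v) : TR) f z = \sum_k u 0 k * dx k f z + \sum_k v 0 k * dy k f z.
Proof. by move=> df; rewrite deriveE ?diff_coord. Qed.

Lemma derive_fst (g : 'rV[R]_n -> R) (u v : 'rV[R]_n) z :
  'D_((u, v) : TR) (fun w => g w.1) z = 'D_u g z.1.
Proof. by []. Qed.

Lemma differentiable_comp_fst (g : 'rV[R]_n -> R) z : differentiable g z.1 ->
  differentiable (fun w : TR => g w.1) z.
Proof.
move=> dg; apply: (@differentiable_comp _ _ _ _ (fun w : TR => w.1) g) => //.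
have lin : linear (fun w : TR => w.1) by [].
pose M := GRing.isLinear.Build _ _ _ _ _ lin.
pose L : {linear TR -> 'rV[R]_n} := HB.pack (fun w : TR => w.1) M.
by apply: (@linear_differentiable _ _ _ L) => w; exact: cvg_fst.
Qed.

Lemma smooth_fst U (g : 'rV[R]_n -> R) : open U -> smooth_on U g ->
  smooth_on [set z : TR | U z.1] (fun z => g z.1).
Proof.
move=> oU /smooth_onP sg; apply/smooth_onP => m.
elim: m g {sg}(sg m) => [|m IH] g [dg cg]; split=> //.
- by move=> x Ux; apply: differentiable_comp_fst; exact: dg.
- by move=> x Ux; apply: differentiable_comp_fst; exact: dg.
- by move=> [u v]; exact: IH (cg u).
Qed.

Lemma is_diff_snd k z : is_diff z (fun w : TR => w.2 0 k) (fun w => w.2 0 k).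
Proof.
have lin : linear (fun w : TR => w.2 0 k : R).
  by move=> a u v /=; rewrite !mxE.
pose M := GRing.isLinear.Build _ _ _ _ _ lin.
pose L : {linear TR -> R} := HB.pack (fun w : TR => w.2 0 k : R) M.
have cL : continuous L.
  move=> w; apply: (@continuous_comp _ _ _ (fun w : TR => w.2)
    (fun y : 'rV[R]_n => y 0 k)); first exact: cvg_snd.
  exact: coord_continuous.
apply: DiffDef; first exact: (@linear_differentiable _ _ _ L).
exact: (@diff_lin _ _ _ L).
Qed.

Lemma differentiable_fibre_coord k z : differentiable (fun w : TR => w.2 0 k) z.
Proof. by have := is_diff_snd k z => /@ex_diff. Qed.

Lemma derive_snd k (v : TR) z : 'D_v (fun w : TR => w.2 0 k) z = v.2 0 k.
Proof.
rewrite deriveE; last exact: differentiable_fibre_coord.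
by have -> := @diff_val _ _ _ _ _ _ _ (is_diff_snd k z).
Qed.

Lemma dx_snd k l z : dx l (fun w => w.2 0 k) z = 0.
Proof. by rewrite /dx derive_snd mxE. Qed.

Lemma dy_snd k l z : dy l (fun w => w.2 0 k) z = (k == l)%:R.
Proof. by rewrite /dy derive_snd mxE. Qed.

Lemma smooth_snd U k : open U -> smooth_on U (fun w : TR => w.2 0 k).
Proof.
move=> oU; apply/smooth_onP => m; case: m => [|m].
  by split=> // x _; exact: differentiable_fibre_coord.
split=> [x _|v]; first exact: differentiable_fibre_coord.
rewrite [X in Ck _ _ X](_ : _ = fun=> v.2 0 k); last first.
  by apply/funext => x; exact: derive_snd.
exact/smooth_Ck/smooth_cst.
Qed.

Lemma smooth_dx U k f : smooth_on U f -> smooth_on U (dx k f).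
Proof. exact: smooth_D. Qed.

Lemma smooth_dy U k f : smooth_on U f -> smooth_on U (dy k f).
Proof. exact: smooth_D. Qed.

(** Differentiating a contraction with the fibre coordinate [y]. *)
Lemma dx_contract (f : 'I_n -> TR -> R) k z :
  (forall j, differentiable (f j) z) ->
  dx k (fun w => \sum_j f j w * w.2 0 j) z = \sum_j dx k (f j) z * z.2 0 j.
Proof.
move=> df; have dm j : differentiable (fun w => f j w * w.2 0 j) z.
  by apply: differentiableM => //; exact: differentiable_fibre_coord.
rewrite {1}/dx der_sum//; apply: eq_bigr => j _.
rewrite derM//; last exact: differentiable_fibre_coord.
by rewrite -/(dx k _ z) -/(dx k _ z) dx_snd mulr0 addr0.
Qed.

Lemma dy_contract (f : 'I_n -> TR -> R) k z :
  (forall j, differentiable (f j) z) ->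
  dy k (fun w => \sum_j f j w * w.2 0 j) z =
  \sum_j dy k (f j) z * z.2 0 j + f k z.
Proof.
move=> df; have dm j : differentiable (fun w => f j w * w.2 0 j) z.
  by apply: differentiableM => //; exact: differentiable_fibre_coord.
rewrite {1}/dy der_sum//.
under eq_bigr => j _.
  rewrite derM//; last exact: differentiable_fibre_coord.
  rewrite -/(dy k _ z) -/(dy k _ z) dy_snd.
  over.
rewrite big_split /=; congr (_ + _).
rewrite (bigD1 k)//= eqxx mulr1 big1 ?addr0// => j /negbTE jk.
by rewrite jk mulr0.
Qed.

End Coordinates.

(* From here on, directional derivatives are handled through their laws only. *)
Local Opaque derive.

(** * The local formulas on a chart *)

(** The properties of a Finsler norm in the coordinates [(x, y)] of one chart,
    on the open cone [U] of the nonzero tangent vectors over the chart. *)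
Record finsler_on (R : realType) (n : nat) (U : set ('rV[R]_n * 'rV[R]_n))
    (F : 'rV[R]_n * 'rV[R]_n -> R) : Prop := FinslerOn {
  fo_open : open U;
  fo_smooth : smooth_on U F;
  fo_neq0 : forall z, U z -> z.2 != 0;
  fo_cone : forall z (l : R), 0 < l -> U z -> U (z.1, l *: z.2);
  fo_homog : forall z (l : R), 0 < l -> U z -> F (z.1, l *: z.2) = l * F z;
  fo_posdef : forall z, U z -> forall v : 'rV[R]_n, v != 0 ->
    0 < \sum_i \sum_j fundamental F i j z * v 0 i * v 0 j }.

Section LocalDefinitions.
Context {R : realType} {n : nat}.
Local Notation TR := ('rV[R]_n * 'rV[R]_n)%type.
Implicit Types (F : TR -> R) (z : TR).

(** Half of the square of the norm; the fundamental tensor is its fibrewise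
    Hessian. *)
Definition energy F : TR -> R := fun w => F w ^+ 2 / 2.

(** The matrix of the fundamental tensor. *)
Definition metric_mx F z : 'M[R]_n := \matrix_(k, l) fundamental F k l z.

(** Minus the Euler-Lagrange covector of the energy, without the term
    [g_il y'^i] that contains the acceleration.  Raising its index gives the
    spray coefficients, see [metric_spray]. *)
Definition euler_lagrange F l z : R :=
  \sum_k dy l (dx k (energy F)) z * z.2 0 k - dx l (energy F) z.

(** [F ^ 2] times the Ricci scalar. *)
Definition ricci_trace F z : R := \sum_i riemann F i i z.

Lemma metric_mxE F z i j : metric_mx F z i j = fundamental F i j z.
Proof. by rewrite mxE. Qed.

End LocalDefinitions.

Section Homogeneous.
Context {R : realType} {n : nat}.
Local Notation TR := ('rV[R]_n * 'rV[R]_n)%type.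
Context (U : set TR) (oU : open U)
  (coneU : forall z (l : R), 0 < l -> U z -> U (z.1, l *: z.2)).
Implicit Types (f : TR -> R) (z : TR).

(** Positive homogeneity of degree [d] along the fibres. *)
Definition homog (d : nat) f :=
  forall z (l : R), 0 < l -> U z -> f (z.1, l *: z.2) = l ^+ d * f z.

Let is_diff_dilate (l : R) z :
  is_diff z (fun w : TR => (w.1, l *: w.2)) (fun w : TR => (w.1, l *: w.2)).
Proof.
have lin : linear (fun w : TR => (w.1, l *: w.2) : TR).
  move=> a [u v] [u' v'] /=; congr pair.
  by rewrite /= scalerDr !scalerA mulrC.
pose M := GRing.isLinear.Build _ _ _ _ _ lin.
pose L : {linear TR -> TR} := HB.pack (fun w : TR => (w.1, l *: w.2) : TR) M.
have cL : continuous (fun w : TR => (w.1, l *: w.2) : TR).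
  move=> w; apply: (@cvg_pair _ _ _ (nbhs w) (nbhs w.1) (nbhs (l *: w.2))) => /=.
    exact: cvg_fst.
  apply: (@continuous_comp _ _ _ (fun w : TR => w.2) ( *:%R l)).
    exact: cvg_snd.
  exact: scaler_continuous.
apply: DiffDef; first exact: (@linear_differentiable _ _ _ L).
exact: (@diff_lin _ _ _ L).
Qed.

Let derive_dilate f (l : R) z (v : TR) : differentiable f (z.1, l *: z.2) ->
  'D_v (fun w => f (w.1, l *: w.2)) z =
  'D_((v.1, l *: v.2) : TR) f (z.1, l *: z.2).
Proof.
move=> df; have dd := is_diff_dilate l z.
have dd' := @ex_diff _ _ _ _ _ _ _ dd.
have dc := differentiable_comp dd' df.
rewrite (deriveE v dc) (diff_comp dd' df) /= deriveE//.
by have -> := @diff_val _ _ _ _ _ _ _ dd.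
Qed.

Lemma homog_derive d f z (l : R) (v : TR) :
  homog d f -> smooth_on U f -> 0 < l -> U z ->
  'D_((v.1, l *: v.2) : TR) f (z.1, l *: z.2) = l ^+ d * 'D_v f z.
Proof.
move=> hf sf l0 Uz; rewrite -derive_dilate; last first.
  by apply: smooth_diff sf _; exact: coneU.
rewrite -derZ; last exact: smooth_diff sf Uz.
by apply: der_eq_on oU _ Uz => w; exact: hf.
Qed.

Lemma homog_dx d f k : homog d f -> smooth_on U f -> homog d (dx k f).
Proof.
move=> hf sf z l l0 Uz.
by have := homog_derive (delta_mx 0 k, 0) hf sf l0 Uz; rewrite /= scaler0.
Qed.

Lemma homog_dy d f k : homog d.+1 f -> smooth_on U f -> homog d (dy k f).
Proof.
move=> hf sf z l l0 Uz.
have := homog_derive (0, delta_mx 0 k) hf sf l0 Uz => /=.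
have df : differentiable f (z.1, l *: z.2).
  by apply: smooth_diff sf _; exact: coneU.
have -> : (0, l *: delta_mx 0 k) = l *: ((0, delta_mx 0 k) : TR).
  by congr pair; rewrite scaler0.
rewrite deriveE// linearZ /= -deriveE// exprS -mulrA.
by apply: mulfI; rewrite gt_eqF.
Qed.

(** Euler's identity. *)
Lemma euler d f z : homog d f -> smooth_on U f -> U z ->
  \sum_k dy k f z * z.2 0 k = d%:R * f z.
Proof.
move=> hf sf Uz.
have df : differentiable f z by exact: smooth_diff sf Uz.
pose line (l : R) : TR := l *: ((0, z.2) : TR) + (z.1, 0).
have lineE l : line l = (z.1, l *: z.2).
  by rewrite /line; congr pair; rewrite /= ?scaler0 ?add0r ?addr0.
have line1 : line 1 = z by rewrite lineE scale1r -surjective_pairing.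
(* both sides are the derivative at [l = 1] of [f] along the ray through [z] *)
have d1 : is_derive (1 : R) 1 (fun l => f (line l)) ('D_((0, z.2) : TR) f (line 1)).
  by apply: is_derive_line; rewrite -/(line 1) line1.
have near1 : \forall l \near (1 : R), f (line l) = l ^+ d * f z.
  near=> l; rewrite lineE hf//; near: l.
  exact: lt_nbhsr.
have d2 : is_derive (1 : R) 1 (fun l => l ^+ d * f z) (d%:R * f z).
  have -> : (fun l : R => l ^+ d * f z) = (fun l : R => f z *: (id ^+ d) l).
    by apply/funext => l; rewrite exprfctE /GRing.scale/= mulrC.
  apply: is_derive_eq.
  by rewrite expr1n mulr1 /GRing.scale/= mulr1 mulrC.
have := @near_eq_derive _ _ _ (fun l => f (line l))
  (fun l : R => l ^+ d * f z) (1 : R) 1 near1.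
rewrite (@derive_val _ _ _ _ _ _ _ d1) (@derive_val _ _ _ _ _ _ _ d2) line1.
rewrite der_coord// => <-.
rewrite [X in _ = X + _]big1 ?add0r => [|k _]; last by rewrite mxE mul0r.
by apply: eq_bigr => k _; rewrite mulrC.
Unshelve. all: by end_near. Qed.

End Homogeneous.

Section LocalSmoothness.
Context {R : realType} {n : nat}.
Local Notation TR := ('rV[R]_n * 'rV[R]_n)%type.
Context (U : set TR) (F : TR -> R) (FU : finsler_on U F).
Implicit Types (z : TR) (i j k l : 'I_n).

Let oU := fo_open FU.

Lemma normsqE : (fun w => F w ^+ 2) = (fun w => 2 * energy F w).
Proof. by apply/funext => w; rewrite /energy mulrC divfK ?pnatr_eq0. Qed.

Lemma smooth_normsq : smooth_on U (fun w => F w ^+ 2).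
Proof.
by apply: smooth_eq (smoothM oU (fo_smooth FU) (fo_smooth FU)) => // w _.
Qed.

Lemma smooth_energy : smooth_on U (energy F).
Proof.
apply: smooth_eq (smoothZ 2^-1 oU smooth_normsq) => // w _.
by rewrite mulrC.
Qed.

Lemma smooth_fundamental i j : smooth_on U (fundamental F i j).
Proof. exact/smooth_dy/smooth_dy/smooth_energy. Qed.

Lemma fundamental_sym i j z : U z -> fundamental F i j z = fundamental F j i z.
Proof. exact: young oU smooth_energy. Qed.

Lemma metric_unit z : U z -> metric_mx F z \in unitmx.
Proof.
move=> Uz; have ker0 (v : 'rV[R]_n) : v *m metric_mx F z = 0 -> v = 0.
  move=> vg; apply/eqP/contraT => v0.
  have := fo_posdef FU Uz v0.
  rewrite exchange_big /= big1 ?ltxx// => j _.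
  have := congr1 (fun A : 'rV_n => A 0 j) vg; rewrite /= !mxE => vgj.
  rewrite -mulr_suml; under eq_bigr do rewrite mulrC.
  have -> : \sum_i v 0 i * fundamental F i j z = 0.
    by rewrite -[RHS]vgj; apply: eq_bigr => k _; rewrite mxE.
  by rewrite mul0r.
rewrite -row_free_unit -kermx_eq0; apply/eqP/row_matrixP => i.
rewrite row0; apply: ker0; apply/sub_kermxP; exact: row_sub.
Qed.

Lemma smooth_fundamental_inv i j : smooth_on U (fundamental_inv F i j).
Proof.
apply: smooth_invmx => // [z|k l]; first exact: metric_unit.
by apply: smooth_eq (smooth_fundamental k l) => // w _; rewrite mxE.
Qed.

Lemma smooth_euler_lagrange l : smooth_on U (euler_lagrange F l).
Proof.
apply: smoothB => //; last exact/smooth_dx/smooth_energy.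
apply: smooth_sum => // k; apply: smoothM => //; last exact: smooth_snd.
exact/smooth_dy/smooth_dx/smooth_energy.
Qed.

(** The spray coefficients in terms of the energy instead of [F ^ 2]. *)
Lemma sprayE i z : U z ->
  spray F i z = \sum_l fundamental_inv F i l z * euler_lagrange F l z.
Proof.
move=> Uz; have sE := smooth_energy.
rewrite /spray normsqE mulr_sumr; apply: eq_bigr => l _.
have dxE k w : U w ->
    dx k (fun w => 2 * energy F w) w = 2 * dx k (energy F) w.
  by move=> Uw; apply: derZ; exact: smooth_diff sE Uw.
have dydxE k : dy l (dx k (fun w => 2 * energy F w)) z =
    2 * dy l (dx k (energy F)) z.
  apply: etrans (der_eq_on _ oU (dxE k) Uz) _.
  by apply: derZ; exact: smooth_diff (smooth_dx k sE) Uz.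
have sumE : \sum_k dy l (dx k (fun w => 2 * energy F w)) z * z.2 0 k =
    2 * \sum_k dy l (dx k (energy F)) z * z.2 0 k.
  rewrite mulr_sumr; apply: eq_bigr => k _.
  by apply: etrans (congr1 (fun t => t * z.2 0 k) (dydxE k)) _; rewrite mulrA.
apply: etrans (congr2 (fun a b => 2^-1 * (fundamental_inv F i l z * (a - b)))
  sumE (dxE l z Uz)) _.
by rewrite -mulrBr mulrCA mulKf ?pnatr_eq0.
Qed.

(** The defining equation of the spray coefficients. *)
Lemma metric_spray i z : U z ->
  \sum_j fundamental F i j z * spray F j z = euler_lagrange F i z.
Proof.
move=> Uz.
have -> : \sum_j fundamental F i j z * spray F j z =
    (metric_mx F z *m (invmx (metric_mx F z) *m \col_l euler_lagrange F l z)) i 0.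
  rewrite mxE; apply: eq_bigr => j _; rewrite sprayE// !mxE.
  by congr (_ * _); apply: eq_bigr => l _; rewrite [in RHS]mxE.
by rewrite mulmxA mulmxV ?metric_unit// mul1mx mxE.
Qed.

Lemma smooth_spray i : smooth_on U (spray F i).
Proof.
apply: (@smooth_eq _ _ _ _
  (fun z => \sum_l fundamental_inv F i l z * euler_lagrange F l z)) => //.
  by move=> z /sprayE.
apply: smooth_sum => // l; apply: smoothM => //.
  exact: smooth_fundamental_inv.
exact: smooth_euler_lagrange.
Qed.

Lemma smooth_riemann i k : smooth_on U (riemann F i k).
Proof.
apply: smoothB => //; last first.
  apply: smoothZ => //; apply: smooth_sum => // j.
  by apply: smoothM => //; exact: smooth_dy (smooth_spray _).
apply: smoothD => //; last first.
  apply: smoothZ => //; apply: smooth_sum => // j.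
  apply: smoothM => //; first exact: smooth_spray.
  exact: smooth_dy (smooth_dy _ (smooth_spray _)).
apply: smoothB => //; first exact: smooth_dx (smooth_spray _).
apply: smoothZ => //; apply: smooth_sum => // j.
apply: smoothM => //; last exact: smooth_snd.
exact: smooth_dy (smooth_dx _ (smooth_spray _)).
Qed.

Lemma smooth_ricci_trace : smooth_on U (ricci_trace F).
Proof. by apply: smooth_sum => // i; exact: smooth_riemann. Qed.

Lemma homog_energy : homog U 2 (energy F).
Proof. by move=> z l l0 Uz; rewrite /energy (fo_homog FU)// exprMn mulrA. Qed.

Lemma fundamental_contract i z : U z ->
  \sum_j fundamental F i j z * z.2 0 j = dy i (energy F) z.
Proof.
move=> Uz; have hE := homog_dy oU (fo_cone FU) i homog_energy smooth_energy.
have := euler hE (smooth_dy i smooth_energy) Uz.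
by rewrite mul1r.
Qed.

Lemma energy_contract z : U z ->
  \sum_j dy j (energy F) z * z.2 0 j = 2 * energy F z.
Proof. exact: euler homog_energy smooth_energy. Qed.

(** Euler's identity gives [F ^ 2 = g_ij y^i y^j], which is positive. *)
Lemma norm_neq0 z : U z -> F z != 0.
Proof.
move=> Uz; have := fo_posdef FU Uz (fo_neq0 FU Uz).
have -> : \sum_i \sum_j fundamental F i j z * z.2 0 i * z.2 0 j = F z ^+ 2.
  have -> : F z ^+ 2 = 2 * energy F z.
    by have /(congr1 (fun f => f z)) := normsqE.
  rewrite -energy_contract//; apply: eq_bigr => i _.
  rewrite -fundamental_contract// mulr_suml; apply: eq_bigr => j _.
  by rewrite mulrAC.
by apply: contraTneq => ->; rewrite expr0n ltxx.
Qed.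

(** The factors [F ^ 2] and [F ^ -2] cancel because [F] does not vanish. *)
Lemma ricciE i k z : U z -> ricci F i k z = 2^-1 * dy k (dy i (ricci_trace F)) z.
Proof.
move=> Uz.
have E w : U w -> F w ^+ 2 * ricci_scalar F w = ricci_trace F w.
  by move=> Uw; rewrite /ricci_scalar mulrC divfK// expf_neq0// norm_neq0.
have dE w : U w -> dy i (fun w => F w ^+ 2 * ricci_scalar F w) w =
    dy i (ricci_trace F) w.
  by move=> Uw; exact: der_eq_on oU E Uw.
exact: (congr1 ( *%R 2^-1) (der_eq_on (0, delta_mx 0 k) oU dE Uz)).
Qed.

Lemma smooth_ricci i k : smooth_on U (ricci F i k).
Proof.
have E w : U w -> 2^-1 * dy k (dy i (ricci_trace F)) w = ricci F i k w.
  by move=> Uw; rewrite ricciE.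
apply: (smooth_eq oU E); apply: (smoothZ _ oU).
exact: smooth_dy (smooth_dy _ smooth_ricci_trace).
Qed.

Lemma ricci_sym i k z : U z -> ricci F i k z = ricci F k i z.
Proof.
move=> Uz; rewrite (ricciE i k Uz) (ricciE k i Uz).
exact: (congr1 ( *%R 2^-1) (young _ _ oU smooth_ricci_trace Uz)).
Qed.

Lemma homog_spray i : homog U 2 (spray F i).
Proof.
have cU := fo_cone FU; have hE := homog_energy; have sE := smooth_energy.
move=> z l l0 Uz; have Uz' : U (z.1, l *: z.2) by exact: cU.
have gE : metric_mx F (z.1, l *: z.2) = metric_mx F z.
  apply/matrixP => p q; apply: etrans (metric_mxE F _ p q) _.
  apply: etrans (esym (metric_mxE F z p q)).
  have := homog_dy oU cU q (homog_dy oU cU p hE sE) (smooth_dy p sE) l0 Uz.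
  by rewrite expr0 mul1r.
have finvE h : fundamental_inv F i h (z.1, l *: z.2) = fundamental_inv F i h z.
  exact: (congr1 (fun A => invmx A i h) gE).
have lagE h : euler_lagrange F h (z.1, l *: z.2) = l ^+ 2 * euler_lagrange F h z.
  rewrite /euler_lagrange (homog_dx oU cU h hE sE l0 Uz) mulrBr mulr_sumr.
  congr +%R; apply: eq_bigr => k _.
  rewrite (homog_dy oU cU h (homog_dx oU cU k hE sE) (smooth_dx k sE) l0 Uz) mxE.
  by rewrite expr1 expr2; ring.
rewrite (sprayE i Uz) (sprayE i Uz') mulr_sumr; apply: eq_bigr => h _.
apply: etrans (congr2 ( *%R) (finvE h) (lagE h)) _.
exact: mulrCA.
Qed.

Lemma nonlinear_connection_contract i z : U z ->
  \sum_k nonlinear_connection F i k z * z.2 0 k = spray F i z.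
Proof.
move=> Uz; rewrite /nonlinear_connection.
under eq_bigr do rewrite -mulrA.
rewrite -mulr_sumr (euler (@homog_spray i) (smooth_spray i) Uz).
by rewrite mulKf// pnatr_eq0.
Qed.

Lemma berwald_contract i z : U z ->
  \sum_j \sum_k berwald_coef F i j k z * z.2 0 j * z.2 0 k = spray F i z.
Proof.
move=> Uz; rewrite -nonlinear_connection_contract//; apply: eq_bigr => j _.
rewrite /berwald_coef /nonlinear_connection.
have hG := homog_dy oU (fo_cone FU) j (@homog_spray i) (smooth_spray i).
have e1 := euler hG (smooth_dy j (smooth_spray i)) Uz.
rewrite mul1r in e1; rewrite -[in RHS]e1 -mulrA mulr_suml mulr_sumr; apply: eq_bigr => k _.
by ring.
Qed.

(** The part of the horizontal derivative that involves the fibre derivatives of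
    the fundamental tensor drops out: they form a totally symmetric tensor that
    is annihilated by [y]. *)
Lemma delta_fundamental_contract h k z : U z ->
  \sum_j delta F k (fundamental F h j) z * z.2 0 j = dx k (dy h (energy F)) z.
Proof.
move=> Uz.
have dg j : differentiable (fundamental F h j) z.
  exact: smooth_diff (smooth_fundamental h j) Uz.
have gE w : U w -> \sum_j fundamental F h j w * w.2 0 j = dy h (energy F) w.
  exact: fundamental_contract.
have dxg : \sum_j dx k (fundamental F h j) z * z.2 0 j =
    dx k (dy h (energy F)) z.
  apply: etrans (esym (dx_contract k dg)) _.
  exact: der_eq_on oU gE Uz.
have dyg l : \sum_j dy l (fundamental F h j) z * z.2 0 j = 0.
  apply: (@addIr _ (fundamental F h l z)).
  apply: etrans (esym (dy_contract l dg)) _.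
  apply: etrans (esym (add0r _)).
  exact: der_eq_on oU gE Uz.
rewrite /delta.
under eq_bigr do rewrite mulrBl mulr_suml.
rewrite sumrB dxg exchange_big /= big1 ?subr0// => l _.
under eq_bigr do rewrite -mulrA.
by rewrite -mulr_sumr dyg mulr0.
Qed.

Let contract_sum (a : 'I_n -> R) (c : 'I_n -> 'I_n -> 'I_n -> R) (y : 'I_n -> R) :
  \sum_j \sum_k (2^-1 * \sum_h a h * c h j k) * y j * y k
  = \sum_h a h * (2^-1 * \sum_j \sum_k c h j k * y j * y k).
Proof.
transitivity (\sum_j \sum_k \sum_h a h * (2^-1 * (c h j k * y j * y k))).
  apply: eq_bigr => j _; apply: eq_bigr => k _.
  rewrite mulr_sumr !mulr_suml; apply: eq_bigr => h _; ring.
under eq_bigr => j _ do rewrite exchange_big.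
rewrite exchange_big; apply: eq_bigr => h _; rewrite !mulr_sumr.
by apply: eq_bigr => j _; rewrite !mulr_sumr.
Qed.

Let contract_split (a b c : 'I_n -> 'I_n -> R) (y : 'I_n -> R) s t :
  \sum_j \sum_k a j k * y j * y k = s ->
  \sum_j \sum_k b j k * y j * y k = s ->
  \sum_j \sum_k c j k * y j * y k = 2 * t ->
  2^-1 * \sum_j \sum_k (a j k + b j k - c j k) * y j * y k = s - t.
Proof.
move=> sa sb sc.
under eq_bigr => j _ do under eq_bigr => k _ do rewrite !mulrBl !mulrDl.
under eq_bigr => j _ do rewrite sumrB big_split /=.
by rewrite sumrB big_split /= sa sb sc; field.
Qed.

(** The contracted Christoffel-type formula is the Euler-Lagrange expression with
    its index raised. *)
Lemma chern_contract i z : U z ->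
  \sum_j \sum_k chern_coef F i j k z * z.2 0 j * z.2 0 k = spray F i z.
Proof.
move=> Uz; have sE := smooth_energy.
apply: etrans (contract_sum (fun h => fundamental_inv F i h z)
  (fun h j k => delta F k (fundamental F h j) z
    + delta F j (fundamental F k h) z - delta F h (fundamental F j k) z)
  (fun j => z.2 0 j)) _.
apply: etrans _ (esym (sprayE i Uz)); apply: eq_bigr => h _.
apply: (congr1 ( *%R (fundamental_inv F i h z))).
have t1 : \sum_j \sum_k delta F k (fundamental F h j) z * z.2 0 j * z.2 0 k =
    \sum_k dy h (dx k (energy F)) z * z.2 0 k.
  rewrite exchange_big; apply: eq_bigr => k _; rewrite -mulr_suml.
  apply: (congr1 (fun t => t * z.2 0 k)).
  apply: etrans (delta_fundamental_contract h k Uz) _.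
  exact: young oU sE Uz.
have delta_sym j k l :
    delta F j (fundamental F k l) z = delta F j (fundamental F l k) z.
  have e (v : TR) : 'D_v (fundamental F k l) z = 'D_v (fundamental F l k) z.
    by apply: (der_eq_on v oU _ Uz) => w; exact: fundamental_sym.
  apply: (congr2 (fun a b => a - b)); first exact: e.
  by apply: eq_bigr => m _; apply: (congr1 ( *%R _)); exact: e.
have t2 : \sum_j \sum_k delta F j (fundamental F k h) z * z.2 0 j * z.2 0 k =
    \sum_k dy h (dx k (energy F)) z * z.2 0 k.
  refine (etrans _ t1); refine (etrans (exchange_big _ _ _ _ _ _) _).
  apply: eq_bigr => j _; apply: eq_bigr => k _.
  refine (etrans (mulrAC _ _ _) _).
  exact: (congr1 (fun t => t * z.2 0 j * z.2 0 k) (delta_sym _ _ _)).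
have t3 : \sum_j \sum_k delta F h (fundamental F j k) z * z.2 0 j * z.2 0 k =
    2 * dx h (energy F) z.
  transitivity (\sum_j dx h (dy j (energy F)) z * z.2 0 j).
    apply: eq_bigr => j _.
    apply: etrans _ (congr1 (fun t => t * z.2 0 j)
      (delta_fundamental_contract j h Uz)).
    rewrite mulr_suml; apply: eq_bigr => k _; exact: mulrAC.
  apply: etrans (esym (dx_contract h _)) _.
    by move=> j; exact: smooth_diff (smooth_dy j sE) Uz.
  apply: etrans _ (derZ _ _ (smooth_diff sE Uz)).
  by apply: (der_eq_on _ oU _ Uz) => w; exact: energy_contract.
exact: (contract_split t1 t2 t3).
Qed.

End LocalSmoothness.

(** * The Ricci tensor along a geodesic *)

Section AlongGeodesic.
Context {R : realType} {n : nat}.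
Local Notation TR := ('rV[R]_n * 'rV[R]_n)%type.
Context (U : set TR) (F : TR -> R) (FU : finsler_on U F).
Implicit Types (z : TR) (i j k l : 'I_n).

(** Contracting the horizontal derivative of the Ricci tensor three times with
    [y] leaves the derivative along the spray, whichever of the connections is
    used: all their coefficients contract to the spray coefficients. *)
Lemma ricci_hderiv_contract (C : 'I_n -> 'I_n -> 'I_n -> TR -> R) z : U z ->
  (forall i, \sum_j \sum_k C i j k z * z.2 0 j * z.2 0 k = spray F i z) ->
  (forall i j k, ricci_hderiv F C i j k z = 0) ->
  \sum_i \sum_j (\sum_k dx k (ricci F i j) z * z.2 0 k
                 - \sum_l spray F l z * dy l (ricci F i j) z)
                * z.2 0 i * z.2 0 j
  = 2 * \sum_i \sum_r ricci F i r z * z.2 0 i * spray F r z.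
Proof.
move=> Uz CG par.
have deltaE i j : \sum_k delta F k (ricci F i j) z * z.2 0 k =
    \sum_k dx k (ricci F i j) z * z.2 0 k
    - \sum_l spray F l z * dy l (ricci F i j) z.
  rewrite /delta; under eq_bigr do rewrite mulrBl.
  rewrite sumrB; congr (_ - _).
  under eq_bigr do rewrite mulr_suml.
  rewrite exchange_big /=; apply: eq_bigr => l _.
  rewrite -(nonlinear_connection_contract FU)// mulr_suml.
  by apply: eq_bigr => k _; rewrite mulrAC.
have contr : \sum_i \sum_j \sum_k
    (\sum_r ricci F i r z * C r j k z) * z.2 0 i * z.2 0 j * z.2 0 k
    = \sum_i \sum_r ricci F i r z * z.2 0 i * spray F r z.
  apply: eq_bigr => i _.
  transitivity (\sum_r \sum_j \sum_k
      ricci F i r z * z.2 0 i * (C r j k z * z.2 0 j * z.2 0 k)).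
    rewrite exchange_big; under [RHS]eq_bigr => r _ do rewrite exchange_big.
    rewrite [RHS]exchange_big; apply: eq_bigr => k _.
    rewrite [RHS]exchange_big; apply: eq_bigr => j _.
    rewrite !mulr_suml; apply: eq_bigr => r _; ring.
  apply: eq_bigr => r _; rewrite -CG mulr_sumr; apply: eq_bigr => j _.
  by rewrite mulr_sumr.
have contr' : \sum_i \sum_j \sum_k
    (\sum_r ricci F j r z * C r i k z) * z.2 0 i * z.2 0 j * z.2 0 k
    = \sum_i \sum_r ricci F i r z * z.2 0 i * spray F r z.
  rewrite -contr exchange_big; apply: eq_bigr => i _; apply: eq_bigr => j _.
  by apply: eq_bigr => k _; ring.
transitivity (\sum_i \sum_j \sum_k
    delta F k (ricci F i j) z * z.2 0 i * z.2 0 j * z.2 0 k).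
  apply: eq_bigr => i _; apply: eq_bigr => j _; rewrite -deltaE !mulr_suml.
  by apply: eq_bigr => k _; ring.
rewrite mulr_natl mulr2n -{1}contr -contr' -big_split; apply: eq_bigr => i _.
rewrite -big_split; apply: eq_bigr => j _; rewrite -big_split; apply: eq_bigr => k _.
have := par i j k; rewrite /ricci_hderiv => /eqP; rewrite subr_eq0 subr_eq => /eqP ->.
by rewrite /=; ring.
Qed.

(** The chain rule along a curve in the tangent bundle. *)
Lemma derive_curve (f : TR -> R) (xi eta : R -> 'rV[R]_n) (s : R) :
  differentiable f (xi s, eta s) -> derivable xi s 1 -> derivable eta s 1 ->
  differentiable (fun t => f (xi t, eta t)) s /\
  'D_1 (fun t => f (xi t, eta t)) s =
    \sum_k derive1 xi s 0 k * dx k f (xi s, eta s)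
    + \sum_k derive1 eta s 0 k * dy k f (xi s, eta s).
Proof.
move=> df /derivable1_diffP dxi /derivable1_diffP deta.
have dp := differentiable_pair dxi deta.
have dc := differentiable_comp dp df.
split=> //.
refine (etrans (deriveE _ dc) _).
rewrite (diff_comp dp df) /= (diff_pair dxi deta) /=.
by rewrite diff_coord// !derive1E !deriveE.
Qed.

Let product_rule (r r' a b yj yj' yk yk' gj gk : R) :
  r' = a - b -> yj' = - gj -> yk' = - gk ->
  (r' * yj + r * yj') * yk + r * yj * yk' =
  (a - b) * yj * yk - (r * gj * yk + r * yj * gk).
Proof. by move=> -> -> ->; ring. Qed.

(** If the horizontal derivative of the Ricci tensor vanishes on a geodesic, then
    so does the derivative of its value on the velocity. *)
Lemma ricci_along_geodesic_derive (xi : R -> 'rV[R]_n) (s : R)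
    (C : 'I_n -> 'I_n -> 'I_n -> TR -> R) :
  let eta := derive1 xi in let z := (xi s, eta s) in
  U z -> derivable xi s 1 -> derivable eta s 1 ->
  (forall i, derive1 eta s 0 i + spray F i z = 0) ->
  (forall i, \sum_j \sum_k C i j k z * z.2 0 j * z.2 0 k = spray F i z) ->
  (forall i j k, ricci_hderiv F C i j k z = 0) ->
  is_derive s 1 (fun t => \sum_j \sum_k ricci F j k (xi t, eta t)
                            * eta t 0 j * eta t 0 k) 0.
Proof.
move=> eta z Uz dxi deta geo CG par.
have dric j k : differentiable (ricci F j k) z.
  exact: smooth_diff (smooth_ricci FU j k) Uz.
have /all_and2[dr derr] := fun jk => derive_curve (dric jk.1 jk.2) dxi deta.
have deta0 : differentiable eta s by exact/derivable1_diffP.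
have de j : differentiable (fun t => eta t 0 j) s.
  apply: (@differentiable_comp _ _ _ _ eta (fun N => N 0 j : R)) => //.
  exact: differentiable_coord.
have dere j : 'D_1 (fun t => eta t 0 j) s = - spray F j z.
  have := geo j; rewrite derive1E derive_mx// mxE => /eqP.
  by rewrite addr_eq0 => /eqP.
have derr2 j k : 'D_1 (fun t => ricci F j k (xi t, eta t)) s =
    \sum_l dx l (ricci F j k) z * z.2 0 l
    - \sum_l spray F l z * dy l (ricci F j k) z.
  refine (etrans (derr (j, k)) _); rewrite -sumrN.
  apply: (congr2 +%R); apply: eq_bigr => l _; first exact: mulrC.
  refine (etrans (congr1 (fun t => t * _) (_ : _ = - spray F l z)) _).
    by have /eqP := geo l; rewrite addr_eq0 => /eqP.
  exact: mulNr.
have d1 j k : differentiable (fun t => ricci F j k (xi t, eta t) * eta t 0 j) s.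
  by apply: differentiableM => //; exact: (dr (j, k)).
have d2 j k : differentiable
    (fun t => ricci F j k (xi t, eta t) * eta t 0 j * eta t 0 k) s.
  exact: differentiableM.
have d3 j : differentiable
    (fun t => \sum_k ricci F j k (xi t, eta t) * eta t 0 j * eta t 0 k) s.
  exact: diff_sum.
apply: DeriveDef; first exact/diff_derivable/diff_sum.
rewrite der_sum//.
transitivity (\sum_i \sum_j (\sum_k dx k (ricci F i j) z * z.2 0 k
                 - \sum_l spray F l z * dy l (ricci F i j) z)
                * z.2 0 i * z.2 0 j
  - (\sum_i \sum_r ricci F i r z * z.2 0 i * spray F r z
     + \sum_i \sum_r ricci F i r z * z.2 0 i * spray F r z)); last first.
  by rewrite (ricci_hderiv_contract Uz CG par); ring.
have -> : \sum_i \sum_r ricci F i r z * z.2 0 i * spray F r z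
     + \sum_i \sum_r ricci F i r z * z.2 0 i * spray F r z =
  \sum_j \sum_k (ricci F j k z * spray F j z * z.2 0 k
                 + ricci F j k z * z.2 0 j * spray F k z).
  under [RHS]eq_bigr do rewrite big_split /=.
  rewrite [RHS]big_split /=; congr (_ + _).
  rewrite exchange_big; apply: eq_bigr => j _; apply: eq_bigr => k _.
  by rewrite (ricci_sym FU)// mulrAC.
rewrite -sumrB; apply: eq_bigr => j _; rewrite der_sum// -sumrB.
apply: eq_bigr => k _; rewrite derM// derM//; last exact: (dr (j, k)).
exact: product_rule (derr2 j k) (dere j) (dere k).
Qed.

End AlongGeodesic.

(** * Coordinate invariance of the Ricci curvature *)

Section ChangeOfCoordinates.
Context {R : realType} {n : nat}.
Local Notation TR := ('rV[R]_n * 'rV[R]_n)%type.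
Context (D : set 'rV[R]_n) (oD : open D)
  (phi : 'rV[R]_n -> 'rV[R]_n) (sphi : smooth_on D phi).
Implicit Types (f : TR -> R) (z w : TR) (i j k l m p : 'I_n).

Let comp m : 'rV[R]_n -> R := fun x => phi x 0 m.
Let e k : 'rV[R]_n := delta_mx 0 k.
Let DT : set TR := [set z | D z.1].

(** [jac m k] is the Jacobian matrix of the change of coordinates [phi], read as
    a function on the tangent bundle. *)
Definition jac m k : TR -> R := fun z => 'D_(e k) (comp m) z.1.

(** [hess m k l] are the second derivatives of [phi]. *)
Definition hess m k l : TR -> R := fun z => 'D_(e l) ('D_(e k) (comp m)) z.1.

(** [hess3 m k l p] are the third derivatives of [phi]. *)
Definition hess3 m k l p : TR -> R :=
  fun z => 'D_(e p) ('D_(e l) ('D_(e k) (comp m))) z.1.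

(** The second derivative of [phi] contracted once with [y]; this is also the
    derivative of the Jacobian matrix along [y]. *)
Definition hess_y m k : TR -> R := fun z => \sum_l hess m l k z * z.2 0 l.

(** The second derivative of [phi] contracted twice with [y]. *)
Definition hess_yy m : TR -> R := fun z => \sum_k hess_y m k z * z.2 0 k.

(** The fibre coordinates of the image of a tangent vector. *)
Definition ytilde m : TR -> R := fun z => \sum_k jac m k z * z.2 0 k.

(** The map that [phi] induces on the tangent bundle; see [tangent_mapE] for the
    form without coordinates. *)
Definition tangent_map : TR -> TR := fun z => (phi z.1, \row_m ytilde m z).

Let Phi := tangent_map.

Let scomp m : smooth_on D (comp m).
Proof. exact: smooth_coord. Qed.

Let oDT : open DT.
Proof. by apply: open_comp => // z _; exact: cvg_fst. Qed.

Lemma smooth_jac m k : smooth_on DT (jac m k).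
Proof. exact: smooth_fst oD (smooth_D _ (scomp m)). Qed.

Lemma smooth_hess m k l : smooth_on DT (hess m k l).
Proof. exact: smooth_fst oD (smooth_D _ (smooth_D _ (scomp m))). Qed.

Lemma hess_sym m k l z : DT z -> hess m k l z = hess m l k z.
Proof. by move=> Dz; exact: young oD (scomp m) Dz. Qed.

Lemma hess3_sym m k l p z : DT z -> hess3 m k l p z = hess3 m k p l z.
Proof. by move=> Dz; exact: young oD (smooth_D _ (scomp m)) Dz. Qed.

Lemma smooth_hess_y m k : smooth_on DT (hess_y m k).
Proof.
apply: (smooth_sum _ _ oDT) => l; apply: (smoothM oDT) (smooth_hess _ _ _) _.
exact: smooth_snd.
Qed.

Lemma smooth_hess_yy m : smooth_on DT (hess_yy m).
Proof.
apply: (smooth_sum _ _ oDT) => l; apply: (smoothM oDT) (smooth_hess_y _ _) _.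
exact: smooth_snd.
Qed.

Lemma dx_jac m k l z : dx l (jac m k) z = hess m k l z.
Proof. exact: (derive_fst ('D_(e k) (comp m)) (e l) 0 z). Qed.

Lemma dy_jac m k l z : dy l (jac m k) z = 0.
Proof. exact: etrans (derive_fst ('D_(e k) (comp m)) 0 (e l) z) (derive0 _ _). Qed.

Lemma dx_hess m k l p z : dx p (hess m k l) z = hess3 m k l p z.
Proof. exact: (derive_fst ('D_(e l) ('D_(e k) (comp m))) (e p) 0 z). Qed.

Lemma dy_hess m k l p z : dy p (hess m k l) z = 0.
Proof.
exact: etrans (derive_fst ('D_(e l) ('D_(e k) (comp m))) 0 (e p) z) (derive0 _ _).
Qed.

Lemma dx_ytilde m k z : DT z -> dx k (ytilde m) z = hess_y m k z.
Proof.
move=> Dz; refine (etrans (dx_contract _ _) _).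
  by move=> j; exact: smooth_diff (smooth_jac m j) Dz.
by apply: eq_bigr => j _; rewrite dx_jac.
Qed.

Lemma dy_ytilde m k z : DT z -> dy k (ytilde m) z = jac m k z.
Proof.
move=> Dz; refine (etrans (dy_contract _ _) _).
  by move=> j; exact: smooth_diff (smooth_jac m j) Dz.
by rewrite big1 ?add0r// => j _; rewrite dy_jac mul0r.
Qed.

Lemma dx_hess_y m k p z : DT z ->
  dx p (hess_y m k) z = \sum_l hess3 m l k p z * z.2 0 l.
Proof.
move=> Dz; refine (etrans (dx_contract _ _) _).
  by move=> j; exact: smooth_diff (smooth_hess m j k) Dz.
by apply: eq_bigr => j _; rewrite dx_hess.
Qed.

Lemma dy_hess_y m k p z : DT z -> dy p (hess_y m k) z = hess m p k z.
Proof.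
move=> Dz; refine (etrans (dy_contract _ _) _).
  by move=> j; exact: smooth_diff (smooth_hess m j k) Dz.
by rewrite big1 ?add0r// => j _; rewrite dy_hess mul0r.
Qed.

Lemma dx_hess_yy m p z : DT z ->
  dx p (hess_yy m) z = \sum_k dx p (hess_y m k) z * z.2 0 k.
Proof.
move=> Dz; refine (etrans (dx_contract _ _) _) => //.
by move=> j; exact: smooth_diff (smooth_hess_y m j) Dz.
Qed.

Lemma hess_y_contract m k z : DT z ->
  \sum_l hess m k l z * z.2 0 l = hess_y m k z.
Proof. by move=> Dz; apply: eq_bigr => l _; rewrite hess_sym. Qed.

Lemma dy_hess_yy m p z : DT z -> dy p (hess_yy m) z = 2 * hess_y m p z.
Proof.
move=> Dz; refine (etrans (dy_contract _ _) _).
  by move=> j; exact: smooth_diff (smooth_hess_y m j) Dz.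
rewrite mulr_natl mulr2n; congr (_ + _); rewrite -hess_y_contract//.
by apply: eq_bigr => j _; rewrite dy_hess_y.
Qed.

Lemma tangent_mapE z : DT z -> Phi z = (phi z.1, 'D_(z.2) phi z.1).
Proof.
move=> Dz; rewrite /Phi /tangent_map; congr pair; apply/rowP => m.
have dphi : differentiable phi z.1 by exact: smooth_diff sphi Dz.
rewrite derive_mx; last exact: diff_derivable.
rewrite !mxE; have dc : differentiable (comp m) z.1.
  exact: smooth_diff (scomp m) Dz.
rewrite [RHS](deriveE _ dc) {1}[z.2]row_sum_delta linear_sum.
by apply: eq_bigr => k _; rewrite linearZ /= -deriveE// mulrC.
Qed.

Let differentiable_row (g : 'I_n -> TR -> R) z :
  (forall m, differentiable (g m) z) ->
  differentiable (fun w => \row_m g m w) z.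
Proof.
move=> dg.
have -> : (fun w => \row_m g m w) = \sum_m (fun w => g m w *: e m).
  apply/funext => w; rewrite fct_sumE [LHS]row_sum_delta.
  by apply: eq_bigr => m _; rewrite mxE.
by apply: differentiable_sum => m; exact: differentiableZl.
Qed.

Let differentiable_base z : DT z -> differentiable (fun w : TR => phi w.1) z.
Proof.
move=> Dz.
have -> : (fun w : TR => phi w.1) = (fun w => \row_m (comp m w.1)).
  by apply/funext => w; apply/rowP => m; rewrite mxE.
apply: differentiable_row => m.
exact: smooth_diff (smooth_fst oD (scomp m)) Dz.
Qed.

Let differentiable_ytilde m z : DT z -> differentiable (ytilde m) z.
Proof.
move=> Dz; apply: diff_sum => k.
apply: differentiableM; first exact: smooth_diff (smooth_jac m k) Dz.
exact: differentiable_fibre_coord.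
Qed.

Let differentiable_fibre z : DT z ->
  differentiable (fun w => \row_m ytilde m w) z.
Proof.
by move=> Dz; apply: differentiable_row => m; exact: differentiable_ytilde.
Qed.

Let der_comp m z (u v : 'rV[R]_n) : DT z ->
  'D_((u, v) : TR) (fun w => comp m w.1) z = \sum_k u 0 k * jac m k z.
Proof.
move=> Dz; refine (etrans (derive_fst (comp m) u v z) _).
have dc : differentiable (comp m) z.1 by exact: smooth_diff (scomp m) Dz.
rewrite (deriveE _ dc) {1}[u]row_sum_delta linear_sum.
by apply: eq_bigr => k _; rewrite linearZ /= -deriveE.
Qed.

Let der_ytilde m z (u v : 'rV[R]_n) : DT z ->
  'D_((u, v) : TR) (ytilde m) z =
  \sum_k u 0 k * hess_y m k z + \sum_k v 0 k * jac m k z.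
Proof.
move=> Dz; refine (etrans (der_coord _ _ (differentiable_ytilde m Dz)) _).
apply: (congr2 +%R); apply: eq_bigr => k _; apply: (congr1 ( *%R _)).
  exact: dx_ytilde.
exact: dy_ytilde.
Qed.

Lemma differentiable_tangent_map z : DT z -> differentiable Phi z.
Proof.
by move=> Dz; apply: differentiable_pair;
  [exact: differentiable_base|exact: differentiable_fibre].
Qed.

(** The chain rule for the induced map of the tangent bundle. *)
Lemma chain_Phi f z (u v : 'rV[R]_n) : DT z -> differentiable f (Phi z) ->
  'D_((u, v) : TR) (fun w => f (Phi w)) z =
  \sum_m (\sum_k u 0 k * jac m k z) * dx m f (Phi z)
  + \sum_m (\sum_k u 0 k * hess_y m k z + \sum_k v 0 k * jac m k z) * dy m f (Phi z).
Proof.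
move=> Dz df.
have db := differentiable_base Dz; have dfb := differentiable_fibre Dz.
have dPhi := differentiable_tangent_map Dz.
refine (etrans (deriveE _ (differentiable_comp dPhi df)) _).
rewrite (diff_comp dPhi df) /=.
have -> : 'd Phi z (u, v) =
    (\row_m \sum_k u 0 k * jac m k z,
     \row_m (\sum_k u 0 k * hess_y m k z + \sum_k v 0 k * jac m k z)).
  refine (etrans (congr1 (fun h => h (u, v)) (diff_pair db dfb)) _).
  apply: (congr2 pair).
    refine (etrans (esym (deriveE _ db)) _).
    refine (etrans (derive_mx (diff_derivable db)) _).
    by apply/rowP => m; rewrite !mxE; exact: der_comp.
  refine (etrans (esym (deriveE _ dfb)) _).
  refine (etrans (derive_mx (diff_derivable dfb)) _).
  apply/rowP => m; rewrite [LHS]mxE [RHS]mxE.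
  refine (etrans _ (der_ytilde m u v Dz)).
  apply: (congr1 (fun g : TR -> R => 'D_((u, v) : TR) g z)).
  by apply/funext => w; rewrite mxE.
rewrite diff_coord//.
by apply: (congr2 +%R); apply: eq_bigr => m _; rewrite mxE.
Qed.

Let sum_delta (k : 'I_n) (a : 'I_n -> R) : \sum_j (e k) 0 j * a j = a k.
Proof.
rewrite (bigD1 k)//= mxE !eqxx mul1r big1 ?addr0// => j /negbTE jk.
by rewrite mxE jk andbF mul0r.
Qed.

Let sum0r (a : 'I_n -> R) : \sum_j (0 : 'rV[R]_n) 0 j * a j = 0.
Proof. by rewrite big1// => j _; rewrite mxE mul0r. Qed.

Let chain_x (k : 'I_n) (Jz Bz : 'I_n -> 'I_n -> R) (fx fy : 'I_n -> R) :
  \sum_m (\sum_j (e k) 0 j * Jz m j) * fx m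
  + \sum_m (\sum_j (e k) 0 j * Bz m j
             + \sum_j (0 : 'rV[R]_n) 0 j * Jz m j) * fy m
  = \sum_m Jz m k * fx m + \sum_m Bz m k * fy m.
Proof.
by congr (_ + _); apply: eq_bigr => m _; rewrite ?sum0r sum_delta ?addr0.
Qed.

Let chain_y (k : 'I_n) (Jz Bz : 'I_n -> 'I_n -> R) (fx fy : 'I_n -> R) :
  \sum_m (\sum_j (0 : 'rV[R]_n) 0 j * Jz m j) * fx m
  + \sum_m (\sum_j (0 : 'rV[R]_n) 0 j * Bz m j
             + \sum_j (e k) 0 j * Jz m j) * fy m
  = \sum_m Jz m k * fy m.
Proof.
rewrite big1 ?add0r => [|m _]; last by rewrite sum0r mul0r.
by apply: eq_bigr => m _; rewrite sum0r sum_delta add0r.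
Qed.

Lemma dx_Phi f z k : DT z -> differentiable f (Phi z) ->
  dx k (fun w => f (Phi w)) z =
  \sum_m jac m k z * dx m f (Phi z) + \sum_m hess_y m k z * dy m f (Phi z).
Proof.
move=> Dz df; refine (etrans (chain_Phi _ _ Dz df) _).
exact: (chain_x k (fun m j => jac m j z) (fun m j => hess_y m j z)).
Qed.

Lemma dy_Phi f z k : DT z -> differentiable f (Phi z) ->
  dy k (fun w => f (Phi w)) z = \sum_m jac m k z * dy m f (Phi z).
Proof.
move=> Dz df; refine (etrans (chain_Phi _ _ Dz df) _).
exact: (chain_y k (fun m j => jac m j z) (fun m j => hess_y m j z)
  (fun m => dx m f (Phi z))).
Qed.

End ChangeOfCoordinates.

Section SprayDerivative.
Context {R : realType} {n : nat}.
Local Notation TR := ('rV[R]_n * 'rV[R]_n)%type.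
Context (U : set TR) (F : TR -> R) (FU : finsler_on U F).
Implicit Types (z : TR) (i j k : 'I_n).

(** The value at [z] of the geodesic spray, as a vector field on the tangent
    bundle. *)
Definition spray_vector (F0 : TR -> R) z : TR := (z.2, - \row_i spray F0 i z).

Lemma derive_spray_vector (f : TR -> R) z : differentiable f z ->
  'D_(spray_vector F z) f z =
  \sum_k dx k f z * z.2 0 k - \sum_k spray F k z * dy k f z.
Proof.
move=> df; refine (etrans (der_coord _ _ df) _); rewrite -sumrN.
apply: (congr2 +%R); apply: eq_bigr => k _; first exact: mulrC.
by rewrite !mxE mulNr.
Qed.

Let riemann_algebra (a s t u c : R) :
  s = t - u -> a - 2^-1 * t + 2^-1 * u - c = a - 2^-1 * s - c.
Proof. by move=> ->; ring. Qed.

(** The Riemann curvature through the derivative of the nonlinear connection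
    along the spray. *)
Lemma riemannE i k z : U z ->
  riemann F i k z = dx k (spray F i) z
    - 2^-1 * 'D_(spray_vector F z) (dy k (spray F i)) z
    - 4^-1 * \sum_j dy j (spray F i) z * dy k (spray F j) z.
Proof.
move=> Uz; have sG := smooth_spray FU i; have oU := fo_open FU.
apply: riemann_algebra.
refine (etrans (derive_spray_vector (smooth_diff (smooth_dy k sG) Uz)) _).
apply: (congr2 (fun s t => s - t)); apply: eq_bigr => j _.
  by apply: (congr1 (fun t => t * _)); exact: young oU sG Uz.
by apply: (congr1 ( *%R _)); exact: young oU sG Uz.
Qed.

End SprayDerivative.

(** ** Transformation laws of the metric_mx, the spray and the curvature *)

Section TransformationLaws.
Context {R : realType} {n : nat}.
Local Notation TR := ('rV[R]_n * 'rV[R]_n)%type.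
Context (D : set 'rV[R]_n) (oD : open D)
  (phi : 'rV[R]_n -> 'rV[R]_n) (sphi : smooth_on D phi).
Context (U U' W : set TR) (F F' : TR -> R)
  (FU : finsler_on U F) (FU' : finsler_on U' F') (oW : open W)
  (WU : W `<=` U) (WD : W `<=` [set z | D z.1])
  (WU' : forall z, W z -> U' (tangent_map phi z))
  (FF' : forall z, W z -> F z = F' (tangent_map phi z))
  (Junit : forall z, W z -> (\matrix_(m, k) jac phi m k z) \in unitmx).
Implicit Types (f g : TR -> R) (z w : TR) (i j k l m p : 'I_n).

Local Notation Phi := (tangent_map phi).
Local Notation J := (jac phi).
Local Notation H := (hess phi).
Local Notation B := (hess_y phi).
Local Notation b := (hess_yy phi).
Local Notation E := (energy F).
Local Notation E' := (energy F').

Let sE := smooth_energy FU.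
Let sE' := smooth_energy FU'.

Let sJ m k : smooth_on W (J m k).
Proof. exact: smooth_sub WD (smooth_jac oD sphi m k). Qed.

Let sB m k : smooth_on W (B m k).
Proof. exact: smooth_sub WD (smooth_hess_y oD sphi m k). Qed.

Let sb m : smooth_on W (b m).
Proof. exact: smooth_sub WD (smooth_hess_yy oD sphi m). Qed.

Let diff_at f z : smooth_on W f -> W z -> differentiable f z.
Proof. exact: smooth_diff. Qed.

Let diff_at' f z : smooth_on U' f -> W z -> differentiable f (Phi z).
Proof. by move=> sf Wz; apply: smooth_diff sf _; exact: WU'. Qed.

Let diff_Phi f z : smooth_on U' f -> W z -> differentiable (fun w => f (Phi w)) z.
Proof.
move=> sf Wz.
have dPhi := differentiable_tangent_map oD sphi (WD Wz).
exact: (differentiable_comp dPhi (diff_at' sf Wz)).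
Qed.

Let dxP f z k : smooth_on U' f -> W z ->
  dx k (fun w => f (Phi w)) z =
  \sum_m J m k z * dx m f (Phi z) + \sum_m B m k z * dy m f (Phi z).
Proof.
by move=> sf Wz; apply: (dx_Phi oD sphi k (WD Wz)); exact: diff_at'.
Qed.

Let dyP f z k : smooth_on U' f -> W z ->
  dy k (fun w => f (Phi w)) z = \sum_m J m k z * dy m f (Phi z).
Proof.
by move=> sf Wz; apply: (dy_Phi oD sphi k (WD Wz)); exact: diff_at'.
Qed.

(** Fibrewise Hessians transform as covariant 2-tensors. *)
Lemma fibre_hessian_Phi f g i j z : smooth_on U' g ->
  (forall w, W w -> f w = g (Phi w)) -> W z ->
  dy j (dy i f) z =
  \sum_m J m i z * \sum_p J p j z * dy p (dy m g) (Phi z).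
Proof.
move=> sg fg Wz.
have dyf w : W w -> dy i f w = \sum_m J m i w * dy m g (Phi w).
  move=> Ww; refine (etrans (der_eq_on _ oW fg Ww) _); exact: dyP.
refine (etrans (der_eq_on _ oW dyf Wz) _).
refine (etrans (der_sum _ _) _).
  move=> m; apply: differentiableM; first exact: diff_at.
  exact: (diff_Phi (smooth_dy m sg)).
apply: eq_bigr => m _.
refine (etrans (derM _ _ _) _); [exact: diff_at|exact: (diff_Phi (smooth_dy m sg))|].
refine (etrans (congr2 +%R (congr1 (fun t => t * _) (dy_jac phi m i j z))
   (congr1 ( *%R _) (dyP j (smooth_dy m sg) Wz))) _).
by rewrite mul0r add0r.
Qed.

Let EE' w : W w -> E w = E' (Phi w).
Proof. by move=> Ww; rewrite /energy FF'. Qed.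

Lemma fundamental_Phi i j z : W z ->
  fundamental F i j z =
  \sum_m J m i z * \sum_p J p j z * fundamental F' m p (Phi z).
Proof. by move=> Wz; exact: fibre_hessian_Phi sE' EE' Wz. Qed.

Let lagrange_algebra (Jz Bz a g : 'I_n -> 'I_n -> R)
    (Hz : 'I_n -> 'I_n -> 'I_n -> R) (c d y yt bz : 'I_n -> R) l :
  (forall m, yt m = \sum_k Jz m k * y k) ->
  (forall m, bz m = \sum_k Bz m k * y k) ->
  (forall m, \sum_k Hz m l k * y k = Bz m l) ->
  \sum_k (\sum_m Jz m k * (\sum_p Jz p l * a p m)
          + \sum_m (Hz m l k * d m + Bz m k * \sum_p Jz p l * g m p)) * y k
    - (\sum_m Jz m l * c m + \sum_m Bz m l * d m)
  = \sum_p Jz p l * ((\sum_m a p m * yt m - c p) + \sum_m g m p * bz m).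
Proof.
move=> ytE bzE HB.
have e1 : \sum_k (\sum_m Jz m k * (\sum_p Jz p l * a p m)) * y k =
    \sum_p Jz p l * \sum_m a p m * yt m.
  under eq_bigr do rewrite mulr_suml.
  rewrite exchange_big /=.
  under [RHS]eq_bigr do rewrite mulr_sumr.
  rewrite [RHS]exchange_big /=; apply: eq_bigr => m _.
  rewrite ytE; under [RHS]eq_bigr do rewrite mulrA.
  rewrite -mulr_suml mulrC mulr_suml; apply: eq_bigr => k _; ring.
have e2 : \sum_k (\sum_m Hz m l k * d m) * y k = \sum_m Bz m l * d m.
  under eq_bigr do rewrite mulr_suml.
  rewrite exchange_big /=; apply: eq_bigr => m _.
  by rewrite -HB mulr_suml; apply: eq_bigr => k _; ring.
have e3 : \sum_k (\sum_m Bz m k * \sum_p Jz p l * g m p) * y k =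
    \sum_p Jz p l * \sum_m g m p * bz m.
  under eq_bigr do rewrite mulr_suml.
  rewrite exchange_big /=.
  under [RHS]eq_bigr do rewrite mulr_sumr.
  rewrite [RHS]exchange_big /=; apply: eq_bigr => m _.
  rewrite bzE; under [RHS]eq_bigr do rewrite mulrA.
  rewrite -mulr_suml mulrC mulr_suml; apply: eq_bigr => k _; ring.
under eq_bigr do rewrite big_split /= mulrDl mulrDl.
rewrite !big_split /= e1 e2 e3.
under [RHS]eq_bigr do rewrite mulrDr mulrBr.
rewrite big_split /= sumrB; ring.
Qed.

(** The transformation law of the Euler-Lagrange expression; the second
    derivatives of the change of coordinates enter through [hess_yy] only. *)
Lemma euler_lagrange_Phi l z : W z ->
  euler_lagrange F l z =
  \sum_p J p l z * (euler_lagrange F' p (Phi z)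
                    + \sum_m fundamental F' m p (Phi z) * b m z).
Proof.
move=> Wz; have Dz := WD Wz.
have dxE k w : W w -> dx k E w =
    \sum_m J m k w * dx m E' (Phi w) + \sum_m B m k w * dy m E' (Phi w).
  by move=> Ww; refine (etrans (der_eq_on _ oW EE' Ww) _); exact: dxP.
have dJ m k : differentiable (J m k) z by exact: diff_at.
have dB m k : differentiable (B m k) z by exact: diff_at.
have dEx m : differentiable (fun w => dx m E' (Phi w)) z.
  exact: (diff_Phi (smooth_dx m sE')).
have dEy m : differentiable (fun w => dy m E' (Phi w)) z.
  exact: (diff_Phi (smooth_dy m sE')).
have dydxE k : dy l (dx k E) z =
    \sum_m J m k z * (\sum_p J p l z * dy p (dx m E') (Phi z))
    + \sum_m (H m l k z * dy m E' (Phi z)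
              + B m k z * \sum_p J p l z * dy p (dy m E') (Phi z)).
  refine (etrans (der_eq_on _ oW (dxE k) Wz) _).
  refine (etrans (derD _ _ _) _).
  - by apply: diff_sum => m; exact: differentiableM.
  - by apply: diff_sum => m; exact: differentiableM.
  apply: (congr2 +%R).
    refine (etrans (der_sum _ _) _) => [m|]; first exact: differentiableM.
    apply: eq_bigr => m _; refine (etrans (derM _ (dJ m k) (dEx m)) _).
    refine (etrans (congr2 +%R (congr1 (fun t => t * _) (dy_jac phi m k l z))
      (congr1 ( *%R _) (dyP l (smooth_dx m sE') Wz))) _).
    by rewrite mul0r add0r.
  refine (etrans (der_sum _ _) _) => [m|]; first exact: differentiableM.
  apply: eq_bigr => m _; refine (etrans (derM _ (dB m k) (dEy m)) _).
  exact: (congr2 +%R (congr1 (fun t => t * _) (dy_hess_y oD sphi m k l Dz))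
      (congr1 ( *%R _) (dyP l (smooth_dy m sE') Wz))).
refine (etrans (congr2 (fun s t => s - t) (eq_bigr _ (fun k _ =>
  congr1 (fun t => t * z.2 0 k) (dydxE k))) (dxE l z Wz)) _).
exact: (@lagrange_algebra (fun m k => J m k z) (fun m k => B m k z)
  (fun p m => dy p (dx m E') (Phi z)) (fun m p => dy p (dy m E') (Phi z))
  (fun m k l => H m k l z) (fun m => dx m E' (Phi z))
  (fun m => dy m E' (Phi z)) (fun k => z.2 0 k) (fun m => (Phi z).2 0 m)
  (fun m => b m z) l (fun m => mxE _ _ _ _)
  (fun m => erefl) (fun m => hess_y_contract oD sphi m l Dz)).
Qed.

(* Raising the index of [euler_lagrange_Phi]: [g] is [J^T g' J], so that one
   factor [J^T] and the factor [g'] can be cancelled. *)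
Let spray_algebra (Jm g' : 'M[R]_n) (G G' bz : 'cV[R]_n) :
  Jm \in unitmx -> g' \in unitmx ->
  (Jm^T *m g' *m Jm) *m G = Jm^T *m (g' *m G' + g' *m bz) ->
  Jm *m G = G' + bz.
Proof.
move=> uJ ug; rewrite -mulmxDr -!mulmxA.
move=> /(congr1 (mulmx (invmx Jm^T))); rewrite !mulKmx ?unitmx_tr//.
by move=> /(congr1 (mulmx (invmx g'))); rewrite !mulKmx.
Qed.

(** The spray coefficients are not a vector: the second derivatives of the
    change of coordinates enter additively. *)
Lemma spray_Phi m z : W z ->
  spray F' m (Phi z) = \sum_i J m i z * spray F i z - b m z.
Proof.
move=> Wz; have Uz := WU Wz; have Uz' := WU' Wz.
pose Jm : 'M[R]_n := \matrix_(m, k) J m k z.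
pose G : 'cV[R]_n := \col_i spray F i z.
pose G' : 'cV[R]_n := \col_i spray F' i (Phi z).
pose bz : 'cV[R]_n := \col_i b i z.
have key : Jm *m G = G' + bz.
  apply: (spray_algebra (Junit Wz) (metric_unit FU' Uz')).
  have -> : Jm^T *m metric_mx F' (Phi z) *m Jm = metric_mx F z.
    apply/matrixP => i j; refine (etrans _ (esym (metric_mxE F z i j))).
    refine (etrans _ (esym (fundamental_Phi i j Wz))).
    rewrite -mulmxA mxE; apply: eq_bigr => p _; rewrite [in LHS]mxE.
    apply: (congr2 ( *%R)); first by rewrite mxE.
    rewrite mxE; apply: eq_bigr => q _; rewrite mulrC metric_mxE.
    by apply: (congr1 (fun t => t * _)); rewrite mxE.
  apply/colP => l.
  refine (etrans (_ : _ = euler_lagrange F l z) _).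
    rewrite mxE -(metric_spray FU l Uz); apply: eq_bigr => j _.
    by rewrite metric_mxE mxE.
  refine (etrans (euler_lagrange_Phi l Wz) _).
  rewrite mxE; apply: eq_bigr => p _.
  apply: (congr2 ( *%R)); first by rewrite !mxE.
  rewrite mxE; apply: (congr2 +%R).
    rewrite mxE -(metric_spray FU' p Uz'); apply: eq_bigr => j _.
    by rewrite metric_mxE mxE.
  rewrite mxE; apply: eq_bigr => q _; rewrite metric_mxE [bz _ _]mxE.
  by apply: (congr1 (fun t => t * _)); exact: (fundamental_sym FU').
have /colP/(_ m) := key; rewrite [RHS]mxE [G' _ _]mxE [bz _ _]mxE.
move=> /esym/(canRL (addrK _)) e; refine (etrans e _).
apply: (congr1 (fun t => t - _)).
by rewrite mxE; apply: eq_bigr => i _; rewrite !mxE.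
Qed.
Let sG i : smooth_on W (spray F i).
Proof. exact: smooth_sub WU (smooth_spray FU i). Qed.

Let sG' i : smooth_on U' (spray F' i).
Proof. exact: smooth_spray FU' i. Qed.

Let der_spray_Phi m z (v : TR) : W z ->
  'D_v (fun w => spray F' m (Phi w)) z =
  \sum_i ('D_v (J m i) z * spray F i z + J m i z * 'D_v (spray F i) z)
  - 'D_v (b m) z.
Proof.
move=> Wz.
have dJ i : differentiable (J m i) z by exact: diff_at.
have dG i : differentiable (spray F i) z by exact: diff_at.
refine (etrans (der_eq_on _ oW (@spray_Phi m) Wz) _).
refine (etrans (derB _ _ _) _).
- by apply: diff_sum => i; exact: differentiableM.
- exact: diff_at.
apply: (congr1 (fun t => t - _)).
refine (etrans (der_sum _ _) _) => [i|]; first exact: differentiableM.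
by apply: eq_bigr => i _; exact: derM.
Qed.

(** The fibre derivative of [spray_Phi]. *)
Lemma dy_spray_Phi m k z : W z ->
  \sum_p J p k z * dy p (spray F' m) (Phi z) =
  \sum_i J m i z * dy k (spray F i) z - 2 * B m k z.
Proof.
move=> Wz; refine (etrans (esym (dyP k (sG' m) Wz)) _).
refine (etrans (der_spray_Phi m _ Wz) _).
refine (congr2 (fun s t => s - t) _ (dy_hess_yy oD sphi m k (WD Wz))).
apply: eq_bigr => i _.
refine (etrans (congr1 (fun t => t * _ + _) (dy_jac phi m i k z)) _).
by rewrite mul0r add0r.
Qed.

(** The derivative of [spray_Phi] along the base. *)
Lemma dx_spray_Phi m k z : W z ->
  \sum_p J p k z * dx p (spray F' m) (Phi z)
  + \sum_p B p k z * dy p (spray F' m) (Phi z) =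
  \sum_i (H m i k z * spray F i z + J m i z * dx k (spray F i) z)
  - \sum_j dx k (B m j) z * z.2 0 j.
Proof.
move=> Wz; refine (etrans (esym (dxP k (sG' m) Wz)) _).
refine (etrans (der_spray_Phi m _ Wz) _).
refine (congr2 (fun s t => s - t) _ (dx_hess_yy oD sphi m k (WD Wz))).
apply: eq_bigr => i _.
exact: (congr1 (fun t => t * _ + _) (dx_jac phi m i k z)).
Qed.

(** The spray is the same vector field in both coordinate systems. *)
Lemma derive_spray_vector_Phi f z : smooth_on U' f -> W z ->
  'D_(spray_vector F z) (fun w => f (Phi w)) z =
  'D_(spray_vector F' (Phi z)) f (Phi z).
Proof.
move=> sf Wz; have df := diff_at' sf Wz.
refine (etrans (chain_Phi oD sphi _ _ (WD Wz) df) _).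
refine (etrans _ (esym (der_coord _ _ df))).
apply: (congr2 +%R); apply: eq_bigr => m _; apply: (congr1 (fun t => t * _)).
  by rewrite mxE; apply: eq_bigr => k _; exact: mulrC.
rewrite mxE mxE; refine (etrans _ (esym (congr1 -%R (spray_Phi m Wz)))).
rewrite opprB; apply: (congr2 +%R).
  by apply: eq_bigr => k _; exact: mulrC.
rewrite -sumrN; apply: eq_bigr => k _.
by rewrite mxE mxE mulNr mulrC.
Qed.

Let spray_jac m k z : W z -> 'D_(spray_vector F z) (J m k) z = B m k z.
Proof.
move=> Wz; refine (etrans (derive_spray_vector F (diff_at (sJ m k) Wz)) _).
rewrite [X in _ - X]big1 ?subr0 => [|l _]; last first.
  by refine (etrans (congr1 ( *%R _) (dy_jac phi m k l z)) _); rewrite mulr0.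
refine (etrans _ (hess_y_contract oD sphi m k (WD Wz))).
apply: eq_bigr => l _; exact: (congr1 (fun t => t * _) (dx_jac phi m k l z)).
Qed.

Let spray_hess_y m k z : W z ->
  'D_(spray_vector F z) (B m k) z =
  \sum_j dx k (B m j) z * z.2 0 j - \sum_j H m j k z * spray F j z.
Proof.
move=> Wz; have Dz := WD Wz.
refine (etrans (derive_spray_vector F (diff_at (sB m k) Wz)) _).
apply: (congr2 (fun s t => s - t)); apply: eq_bigr => j _; last first.
  refine (etrans (congr1 ( *%R _) (dy_hess_y oD sphi m k j Dz)) _).
  exact: mulrC.
apply: (congr1 (fun t => t * _)).
refine (etrans (dx_hess_y oD sphi m k j Dz) _).
refine (etrans _ (esym (dx_hess_y oD sphi m j k Dz))).
apply: eq_bigr => l _; apply: (congr1 (fun t => t * _)).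
exact (hess3_sym oD sphi m l k j Dz).
Qed.

(** The derivative of [dy_spray_Phi] along the spray. *)
Lemma spray_dy_spray_Phi m k z : W z ->
  \sum_p (B p k z * dy p (spray F' m) (Phi z)
          + J p k z * 'D_(spray_vector F' (Phi z)) (dy p (spray F' m)) (Phi z))
  = \sum_i (B m i z * dy k (spray F i) z
            + J m i z * 'D_(spray_vector F z) (dy k (spray F i)) z)
    - 2 * (\sum_j dx k (B m j) z * z.2 0 j - \sum_j H m j k z * spray F j z).
Proof.
move=> Wz; set v := spray_vector F z.
have dJ p : differentiable (J p k) z by exact: diff_at.
have dJ' p : differentiable (J m p) z by exact: diff_at.
have dG' p : differentiable (fun w => dy p (spray F' m) (Phi w)) z.
  exact: (diff_Phi (smooth_dy p (sG' m))).
have dG i : differentiable (dy k (spray F i)) z by exact: diff_at (smooth_dy _ _) Wz.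
have := der_eq_on v oW (fun w => @dy_spray_Phi m k w) Wz => e.
have e1 : 'D_v (fun w => \sum_p J p k w * dy p (spray F' m) (Phi w)) z =
  \sum_p (B p k z * dy p (spray F' m) (Phi z)
          + J p k z * 'D_(spray_vector F' (Phi z)) (dy p (spray F' m)) (Phi z)).
  refine (etrans (der_sum _ _) _) => [p|]; first exact: differentiableM.
  apply: eq_bigr => p _; refine (etrans (derM _ (dJ p) (dG' p)) _).
  apply: (congr2 (fun s t => s * _ + _ * t)); first exact: spray_jac.
  exact: derive_spray_vector_Phi (smooth_dy p (sG' m)) Wz.
refine (etrans (esym e1) _); refine (etrans e _).
refine (etrans (derB _ _ _) _).
- by apply: diff_sum => i; exact: differentiableM.
- by apply: differentiableM => //; exact: diff_at.
apply: (congr2 (fun s t => s - t)).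
  refine (etrans (der_sum _ _) _) => [i|]; first exact: differentiableM.
  apply: eq_bigr => i _; refine (etrans (derM _ (dJ' i) (dG i)) _).
  apply: (congr1 (fun s => s * _ + _)); exact: spray_jac.
refine (etrans (derZ _ _ (diff_at (sB m k) Wz)) _).
by apply: (congr1 ( *%R _)); exact: spray_hess_y.
Qed.

(* The hypotheses are [dy_spray_Phi], [dx_spray_Phi] and [spray_dy_spray_Phi] in
   matrix form, and the conclusion is [R' J = J R] by [riemannE]. *)
Let riemann_algebra (Jm X P Q X' P' Q' Bm HG C : 'M[R]_n) :
  P' *m Jm = Jm *m P - 2 *: Bm ->
  X' *m Jm + P' *m Bm = HG + Jm *m X - C ->
  P' *m Bm + Q' *m Jm = Bm *m P + Jm *m Q - 2 *: (C - HG) ->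
  (X' - 2^-1 *: Q' - 4^-1 *: (P' *m P')) *m Jm =
  Jm *m (X - 2^-1 *: Q - 4^-1 *: (P *m P)).
Proof.
move=> c1 c2 c3.
have c1' : P' *m P' *m Jm = Jm *m P *m P - 2 *: (Bm *m P) - 2 *: (P' *m Bm).
  by rewrite -mulmxA c1 mulmxBr mulmxA c1 mulmxBl -scalemxAl -scalemxAr.
have c2' : X' *m Jm = HG + Jm *m X - C - P' *m Bm by rewrite -c2 addrK.
have c3' : Q' *m Jm = Bm *m P + Jm *m Q - 2 *: (C - HG) - P' *m Bm.
  by rewrite -c3 addrC addKr.
rewrite !mulmxBl !mulmxBr -!scalemxAl -!scalemxAr c1' c2' c3' mulmxA.
move: (Jm *m P *m P) (Bm *m P) (P' *m Bm) (Jm *m X) (Jm *m Q) => A1 A2 A3 A4 A5.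
by apply/matrixP => i j; rewrite !mxE; field.
Qed.

Let similar_trace (Jm A A' : 'M[R]_n) :
  Jm \in unitmx -> A' *m Jm = Jm *m A -> \tr A' = \tr A.
Proof.
move=> uJ e; have -> : A' = Jm *m A *m invmx Jm by rewrite -e mulmxK.
by rewrite mxtrace_mulC mulKmx.
Qed.

(** The trace of the Riemann curvature is a function on the tangent bundle. *)
Lemma ricci_trace_Phi z : W z -> ricci_trace F' (Phi z) = ricci_trace F z.
Proof.
move=> Wz; have Uz := WU Wz; have Uz' := WU' Wz.
pose Jm : 'M[R]_n := \matrix_(m, k) J m k z.
pose X : 'M[R]_n := \matrix_(i, k) dx k (spray F i) z.
pose P : 'M[R]_n := \matrix_(i, k) dy k (spray F i) z.
pose Q : 'M[R]_n :=
  \matrix_(i, k) 'D_(spray_vector F z) (dy k (spray F i)) z.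
pose X' : 'M[R]_n := \matrix_(i, k) dx k (spray F' i) (Phi z).
pose P' : 'M[R]_n := \matrix_(i, k) dy k (spray F' i) (Phi z).
pose Q' : 'M[R]_n :=
  \matrix_(i, k) 'D_(spray_vector F' (Phi z)) (dy k (spray F' i)) (Phi z).
pose Bm : 'M[R]_n := \matrix_(m, k) B m k z.
pose HG : 'M[R]_n := \matrix_(m, k) \sum_j H m j k z * spray F j z.
pose C : 'M[R]_n := \matrix_(m, k) \sum_j dx k (B m j) z * z.2 0 j.
have mulE (f g : 'I_n -> 'I_n -> R) m k :
    ((\matrix_(i, j) f i j) *m (\matrix_(i, j) g i j)) m k =
    \sum_p f m p * g p k.
  by rewrite mxE; apply: eq_bigr => p _; rewrite !mxE.
have mulE' (f g : 'I_n -> 'I_n -> R) m k :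
    ((\matrix_(i, j) f i j) *m (\matrix_(i, j) g i j)) m k =
    \sum_p g p k * f m p.
  by rewrite mxE; apply: eq_bigr => p _; rewrite !mxE mulrC.
have addE (A1 A2 : 'M[R]_n) m k : (A1 + A2) m k = A1 m k + A2 m k.
  by rewrite mxE.
have subE (A1 A2 : 'M[R]_n) m k : (A1 - A2) m k = A1 m k - A2 m k.
  by rewrite !mxE.
have scaleE (c : R) (A1 : 'M[R]_n) m k : (c *: A1) m k = c * A1 m k.
  by rewrite mxE.
have c1 : P' *m Jm = Jm *m P - 2 *: Bm.
  apply/matrixP => m k; rewrite subE scaleE.
  rewrite [LHS]mulE' [X in X - _]mulE [Bm _ _]mxE.
  exact: dy_spray_Phi.
have c2 : X' *m Jm + P' *m Bm = HG + Jm *m X - C.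
  apply/matrixP => m k; rewrite addE subE addE.
  rewrite [X in X + _ = _]mulE' [X in _ + X = _]mulE'.
  rewrite [X in _ + X - _]mulE [HG _ _]mxE [C _ _]mxE -[X in _ = X - _]big_split.
  exact: dx_spray_Phi.
have c3 : P' *m Bm + Q' *m Jm = Bm *m P + Jm *m Q - 2 *: (C - HG).
  apply/matrixP => m k; rewrite addE subE addE scaleE subE.
  rewrite [X in X + _ = _]mulE' [X in _ + X = _]mulE'.
  rewrite [X in X + _ - _]mulE [X in _ + X - _]mulE.
  rewrite [HG _ _]mxE [C _ _]mxE.
  rewrite -[X in X = _]big_split -[X in _ = X - _]big_split.
  exact: spray_dy_spray_Phi.
have traceE V G0 (FV : finsler_on V G0) (w : TR) : V w ->
    ricci_trace G0 w = \tr (\matrix_(i, k) dx k (spray G0 i) w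
      - 2^-1 *: \matrix_(i, k) 'D_(spray_vector G0 w) (dy k (spray G0 i)) w
      - 4^-1 *: ((\matrix_(i, k) dy k (spray G0 i) w)
                 *m (\matrix_(i, k) dy k (spray G0 i) w))).
  move=> Vw; apply: eq_bigr => i _; refine (etrans (riemannE FV i i Vw) _).
  by rewrite subE subE scaleE scaleE mulE !mxE.
refine (etrans (traceE _ _ FU' _ Uz') _).
refine (etrans _ (esym (traceE _ _ FU _ Uz))).
exact: (similar_trace (Junit Wz) (riemann_algebra c1 c2 c3)).
Qed.

(** Hence so is the quadratic form of the Ricci tensor. *)
Lemma ricci_quadratic_Phi z : W z ->
  \sum_j \sum_k ricci F' j k (Phi z) * (Phi z).2 0 j * (Phi z).2 0 k =
  \sum_j \sum_k ricci F j k z * z.2 0 j * z.2 0 k.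
Proof.
move=> Wz; have Uz := WU Wz; have Uz' := WU' Wz.
have ricE j k : ricci F j k z =
    \sum_m J m j z * \sum_p J p k z * ricci F' m p (Phi z).
  rewrite (ricciE FU j k Uz).
  refine (etrans (congr1 ( *%R _) (fibre_hessian_Phi j k
    (smooth_ricci_trace FU') (fun w Ww => esym (@ricci_trace_Phi w Ww)) Wz)) _).
  rewrite mulr_sumr; apply: eq_bigr => m _; rewrite mulrCA.
  apply: (congr1 ( *%R _)); rewrite mulr_sumr; apply: eq_bigr => p _.
  by rewrite (ricciE FU' m p Uz') mulrCA.
symmetry; refine (etrans (eq_bigr _ (fun j _ => eq_bigr _ (fun k _ =>
  congr1 (fun t => t * z.2 0 j * z.2 0 k) (ricE j k)))) _).
have yE m : (Phi z).2 0 m = \sum_k J m k z * z.2 0 k by rewrite mxE.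
have alg (r : 'I_n -> 'I_n -> R) (Jz : 'I_n -> 'I_n -> R) (y yt : 'I_n -> R) :
    (forall m, yt m = \sum_k Jz m k * y k) ->
    \sum_j \sum_k (\sum_m Jz m j * \sum_p Jz p k * r m p) * y j * y k =
    \sum_m \sum_p r m p * yt m * yt p.
  move=> ytE.
  transitivity (\sum_m \sum_p \sum_j \sum_k
      r m p * (Jz m j * y j) * (Jz p k * y k)).
    transitivity (\sum_j \sum_m \sum_p \sum_k
        r m p * (Jz m j * y j) * (Jz p k * y k)).
      apply: eq_bigr => j _; under [RHS]eq_bigr => m _ do rewrite exchange_big.
      rewrite [RHS]exchange_big /=; apply: eq_bigr => k _.
      rewrite !mulr_suml; apply: eq_bigr => m _.
      rewrite mulr_sumr !mulr_suml; apply: eq_bigr => p _; ring.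
    rewrite exchange_big /=; apply: eq_bigr => m _; exact: exchange_big.
  apply: eq_bigr => m _; apply: eq_bigr => p _.
  rewrite (ytE m) (ytE p) [r m p * _]mulr_sumr mulr_suml; apply: eq_bigr => j _.
  by rewrite mulr_sumr.
exact: (alg (fun m p => ricci F' m p (Phi z)) (fun m k => J m k z)
  (fun k => z.2 0 k) (fun m => (Phi z).2 0 m) yE).
Qed.

End TransformationLaws.

(** * The Schwarzian equation *)

Section IntervalCalculus.
Context {R : realType}.
Implicit Types (f g : R -> R) (I : set R) (s t : R).

Lemma is_derive_prod f g (f' g' : R) s : is_derive s 1 f f' -> is_derive s 1 g g' ->
  is_derive s 1 (fun t => f t * g t) (f' * g s + f s * g').
Proof.
move=> df dg; apply: (@is_derive_eq _ _ _ (f * g)).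
by rewrite /GRing.scale/= addrC mulrC.
Qed.

Lemma is_derive_quotient f g (f' g' : R) s :
  g s != 0 -> is_derive s 1 f f' -> is_derive s 1 g g' ->
  is_derive s 1 (fun t => f t / g t) ((f' * g s - f s * g') / g s ^+ 2).
Proof.
move=> g0 df dg.
have dV : is_derive s 1 (fun t => (g t)^-1) (- (g s) ^- 2 *: g') by exact: is_deriveV.
apply: is_derive_eq (is_derive_prod df dV) _.
by rewrite /GRing.scale/=; field.
Qed.

(** A function whose derivative vanishes on an interval is constant there. *)
Lemma constant_on_interval I f : is_interval I ->
  (forall s, I s -> is_derive s 1 f 0) ->
  forall s t, I s -> I t -> f s = f t.
Proof.
move=> itvI df.
suff lt_cst s t : I s -> I t -> s < t -> f s = f t.
  move=> s t Is It; have [st|ts|->//] := ltgtP s t; first exact: lt_cst.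
  by apply/esym; exact: lt_cst.
move=> Is It st.
have Ist r : s <= r <= t -> I r by exact: itvI.
have dr r : r \in `]s, t[%R -> is_derive r 1 f 0.
  by rewrite in_itv/= => /andP[sr rt]; apply/df/Ist; rewrite !ltW.
have cf : {within `[s, t], continuous f}.
  apply: derivable_within_continuous => r; rewrite in_itv/= => /Ist /df.
  by move=> /@ex_derive.
have [c _] := MVT st dr cf.
by rewrite mul0r => /eqP; rewrite subr_eq0 => /eqP.
Qed.

Lemma is_derive_on I f g s (f' : R) : open I -> I s ->
  (forall t, I t -> f t = g t) -> is_derive s 1 g f' -> is_derive s 1 f f'.
Proof.
move=> oI Is fg; apply: near_eq_is_derive.
by apply: near_open_eq oI Is _ => t /fg.
Qed.

End IntervalCalculus.

Section SchwarzianEquation.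
Context {R : realType}.
Implicit Types (p f w : R -> R) (s t : R).

(** Two solutions [u], [v] of the linear equation [w'' + q w = 0], with
    constant Wronskian [om]. *)
Context (q om : R) (u u1 v v1 : R -> R) (om0 : om != 0).
Context (du : forall s, is_derive s 1 u (u1 s))
  (du1 : forall s, is_derive s 1 u1 (- (q * u s)))
  (dv : forall s, is_derive s 1 v (v1 s))
  (dv1 : forall s, is_derive s 1 v1 (- (q * v s)))
  (wronskian : forall s, u s * v1 s - u1 s * v s = om).
Context (I : set R) (oI : open I) (itvI : is_interval I).

(** Variation of constants: [u] and [v] span the solutions on [I]. *)
Lemma linear_solution f f1 : I !=set0 ->
  (forall s, I s -> is_derive s 1 f (f1 s)) ->
  (forall s, I s -> is_derive s 1 f1 (- (q * f s))) ->
  exists al be : R, forall s, I s ->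
    f s = al * u s + be * v s /\ f1 s = al * u1 s + be * v1 s.
Proof.
move=> [s0 Is0] df df1.
pose a s := f s * v1 s - f1 s * v s.
pose b s := u s * f1 s - u1 s * f s.
have da s : I s -> is_derive s 1 a 0.
  move=> Is; apply: is_derive_eq (is_deriveB (is_derive_prod (df s Is) (dv1 s))
    (is_derive_prod (df1 s Is) (dv s))) _.
  by ring.
have db s : I s -> is_derive s 1 b 0.
  move=> Is; apply: is_derive_eq (is_deriveB (is_derive_prod (du s) (df1 s Is))
    (is_derive_prod (du1 s) (df s Is))) _.
  by ring.
(* Cramer's rule; [a] and [b] are constant on [I] *)
exists (a s0 / om), (b s0 / om) => s Is.
rewrite (constant_on_interval itvI da Is0 Is) (constant_on_interval itvI db Is0 Is).
rewrite /a /b -(wronskian s).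
have := om0; rewrite -(wronskian s) => w0.
by split; field.
Qed.

(** [p] has three derivatives at [s] and the first one does not vanish, so that
    the Schwarzian derivative makes sense. *)
Definition thrice_derivable p s : Prop :=
  [/\ derivable p s 1, derivable (derive1 p) s 1, derivable (derive1n 2 p) s 1 &
      derive1 p s != 0].

(** A quotient [N / D] of two solutions has derivative [c / D ^ 2], where the
    constant [c] is the Wronskian of [D] and [N]. *)
Lemma moebius_schwarzian p : moebius_of u v I p ->
  forall s, I s -> thrice_derivable p s /\ schwarzian p s = 2 * q.
Proof.
move=> [al [be [ga [de [det0 pE]]]]].
pose N s := al * u s + be * v s.
pose D s := ga * u s + de * v s.
pose D1 s := ga * u1 s + de * v1 s.
pose c := - ((al * de - be * ga) * om).
have c0 : c != 0 by rewrite oppr_eq0 mulf_neq0.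
have D0 s : I s -> D s != 0 by move=> /pE[].
have dcomb (x y : R) f (f' : R) g (g' : R) s : is_derive s 1 f f' -> is_derive s 1 g g' ->
    is_derive s 1 (fun t => x * f t + y * g t) (x * f' + y * g').
  move=> df dg; exact: (is_deriveD (is_deriveZ x df) (is_deriveZ y dg)).
have dN s : is_derive s 1 N (al * u1 s + be * v1 s) by exact: dcomb.
have dD s : is_derive s 1 D (D1 s) by exact: dcomb.
have dD1 s : is_derive s 1 D1 (- (q * D s)).
  by apply: is_derive_eq (dcomb _ _ _ _ _ _ _ (du1 s) (dv1 s)) _; rewrite /D; ring.
have dp s : I s -> is_derive s 1 p (c / D s ^+ 2).
  move=> Is; apply: (is_derive_on (g := fun t => N t / D t) oI Is).
    by move=> t /pE[].
  apply: is_derive_eq (is_derive_quotient (g := D) (D0 s Is) (dN s) (dD s)) _.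
  by congr (_ / _); rewrite /c -(wronskian s) /N /D /D1; ring.
have p1E s : I s -> derive1 p s = c / D s ^+ 2.
  by move=> Is; rewrite derive1E; have := dp s Is => /@derive_val.
have dD2 s : is_derive s 1 (fun t => D t ^+ 2) (2 * D s * D1 s).
  apply: is_derive_eq (is_derive_prod (dD s) (dD s)) _; ring.
have dp1 s : I s -> is_derive s 1 (derive1 p) (- 2 * c * D1 s / D s ^+ 3).
  move=> Is; apply: (is_derive_on oI Is p1E).
  have D20 : D s ^+ 2 != 0 by rewrite expf_neq0// D0.
  have dc : is_derive s 1 (fun=> c) (0 : R) by exact: is_derive_cst.
  refine (is_derive_eq (is_derive_quotient (g := fun t => D t ^+ 2) D20 dc (dD2 s)) _).
  by have := D0 s Is => ?; field.
have p2E s : I s -> derive1n 2 p s = - 2 * c * D1 s / D s ^+ 3.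
  move=> Is; rewrite /derive1n/= derive1E.
  by have := dp1 s Is => /@derive_val.
have dp2 s : I s -> is_derive s 1 (derive1n 2 p)
    (2 * c * q / D s ^+ 2 + 6 * c * D1 s ^+ 2 / D s ^+ 4).
  move=> Is; apply: (is_derive_on oI Is p2E).
  have D30 : D s ^+ 3 != 0 by rewrite expf_neq0// D0.
  have dD3 : is_derive s 1 (fun t => D t ^+ 3) (3 * D s ^+ 2 * D1 s).
    apply: is_derive_eq (is_derive_prod (dD s) (dD2 s)) _; ring.
  have dn : is_derive s 1 (fun t => - 2 * c * D1 t) (2 * c * q * D s).
    apply: is_derive_eq (is_deriveZ (- 2 * c) (dD1 s)) _.
    by rewrite /GRing.scale/=; ring.
  apply: is_derive_eq (is_derive_quotient (g := fun t => D t ^+ 3) D30 dn dD3) _.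
  by have := D0 s Is => ?; field.
move=> s Is; have Ds := D0 s Is; split.
  split.
  - by have := dp s Is => /@ex_derive.
  - by have := dp1 s Is => /@ex_derive.
  - by have := dp2 s Is => /@ex_derive.
  - by rewrite p1E// mulf_neq0// invr_eq0 expf_neq0.
have p3E : derive1n 3 p s = 2 * c * q / D s ^+ 2 + 6 * c * D1 s ^+ 2 / D s ^+ 4.
  by rewrite derive1nS derive1E; have := dp2 s Is => /@derive_val.
rewrite /schwarzian p1E// p2E// p3E.
by field; rewrite c0 Ds.
Qed.

(** If [{p, s} = 2 q], then [w = |p'|^(-1/2)] and [p w] both solve
    [w'' + q w = 0], and [p] is their quotient. *)
Lemma schwarzian_moebius p :
  (forall s, I s -> thrice_derivable p s /\ schwarzian p s = 2 * q) ->
  moebius_of u v I p.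
Proof.
have [I0|I0] := pselect (I !=set0); last first.
  (* on the empty interval every nondegenerate matrix will do *)
  move=> _; exists 1, 0, 0, 1; split; first by rewrite mulr1 mulr0 subr0 oner_neq0.
  by move=> s Is; exfalso; apply: I0; exists s.
move=> hp; pose p1 := derive1 p; pose p2 := derive1n 2 p.
have isd f s : derivable f s 1 -> is_derive s 1 f (derive1 f s).
  by move=> df; rewrite derive1E; exact: derivableP.
have dp s : I s -> is_derive s 1 p (p1 s) by move=> /hp[[? _ _ _] _]; exact: isd.
have dp1 s : I s -> is_derive s 1 p1 (p2 s).
  by move=> /hp[[_ ? _ _] _]; exact: isd.
have dp2 s : I s -> is_derive s 1 p2 (derive1n 3 p s).
  by move=> /hp[[_ _ ? _] _]; exact: isd.
have p10 s : I s -> p1 s != 0 by move=> /hp[[]].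
(* the fourth root of [p' ^ 2] avoids a discussion of the sign of [p'] *)
pose w s := expR (- 4^-1 * ln (p1 s ^+ 2)).
pose w1 s := - 2^-1 * (p2 s / p1 s) * w s.
have w0 s : w s != 0 by rewrite gt_eqF// expR_gt0.
have dw s : I s -> is_derive s 1 w (w1 s).
  move=> Is; have p0 := p10 s Is.
  have p2gt0 : 0 < p1 s ^+ 2 by rewrite exprn_even_gt0.
  have dsq : is_derive s 1 (fun t => p1 t ^+ 2) (2 * p1 s * p2 s).
    apply: is_derive_eq (is_derive_prod (dp1 s Is) (dp1 s Is)) _; ring.
  have dln := is_derive1_comp (f := @ln R) (g := fun t => p1 t ^+ 2)
    (is_derive1_ln p2gt0) dsq.
  have dZ := is_deriveZ (- 4^-1) dln.
  apply: is_derive_eq (is_derive1_comp (f := expR) (is_derive_expR _) dZ) _.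
  by rewrite /w1 /w /GRing.scale/=; field.
have dw1 s : I s -> is_derive s 1 w1 (- (q * w s)).
  move=> Is; have p0 := p10 s Is.
  have dr := is_deriveZ (- 2^-1) (is_derive_quotient (g := p1) p0 (dp2 s Is) (dp1 s Is)).
  apply: is_derive_eq (is_derive_prod dr (dw s Is)) _.
  have [_] := hp s Is; rewrite /schwarzian -/p1 -/p2 => sch.
  have -> : q = (2 * q) / 2 by field.
  by rewrite -sch /w1 /= /GRing.scale/= -/p1; field.
pose f s := p s * w s.
pose f1 s := p1 s * w s + p s * w1 s.
have df s : I s -> is_derive s 1 f (f1 s).
  by move=> Is; exact: is_derive_prod (dp s Is) (dw s Is).
have df1 s : I s -> is_derive s 1 f1 (- (q * f s)).
  move=> Is; have p0 := p10 s Is.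
  apply: is_derive_eq (is_deriveD (is_derive_prod (dp1 s Is) (dw s Is))
    (is_derive_prod (dp s Is) (dw1 s Is))) _.
  by rewrite /f /w1; field.
have [al [be fE]] := linear_solution I0 df df1.
have [ga [de wE]] := linear_solution I0 dw dw1.
exists al, be, ga, de; split.
  have [s Is] := I0.
  (* the Wronskian of [p w] and [w] is [p' w ^ 2] *)
  have : f1 s * w s - f s * w1 s != 0.
    have -> : f1 s * w s - f s * w1 s = p1 s * w s * w s by rewrite /f1 /f; ring.
    by rewrite !mulf_neq0// p10.
  have [-> ->] := fE s Is; have [-> ->] := wE s Is.
  apply: contraNneq => d0.
  have -> : (al * u1 s + be * v1 s) * (ga * u s + de * v s) -
    (al * u s + be * v s) * (ga * u1 s + de * v1 s) =
    - (al * de - be * ga) * (u s * v1 s - u1 s * v s) by ring.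
  by rewrite d0 oppr0 mul0r.
move=> s Is; have [<- _] := wE s Is; have [<- _] := fE s Is.
by split=> //; rewrite /f mulfK.
Qed.

End SchwarzianEquation.

Section ConcreteSolutions.
Context {R : realType}.
Implicit Types (c s : R).

Let is_derive_scale c s : is_derive s 1 (fun t => c * t) c.
Proof.
apply: is_derive_eq (is_deriveZ c (is_derive_id s 1)) _.
by rewrite /GRing.scale/= mulr1.
Qed.

Let is_derive_cstM c (f : R -> R) (f' : R) s :
  is_derive s 1 f f' -> is_derive s 1 (fun t => c * f t) (c * f').
Proof. by move=> df; exact: is_deriveZ. Qed.

Lemma is_derive_cos_scale c s :
  is_derive s 1 (fun t => cos (c * t)) (- c * sin (c * s)).
Proof.
apply: is_derive_eq (is_derive1_comp (f := cos) (is_derive_cos _) (is_derive_scale c s)) _.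
by ring.
Qed.

Lemma is_derive_sin_scale c s :
  is_derive s 1 (fun t => sin (c * t)) (c * cos (c * s)).
Proof.
apply: is_derive_eq (is_derive1_comp (f := sin) (is_derive_sin _) (is_derive_scale c s)) _.
by ring.
Qed.

Lemma is_derive_expR_scale c s :
  is_derive s 1 (fun t => expR (c * t)) (c * expR (c * s)).
Proof.
apply: is_derive_eq (is_derive1_comp (f := expR) (is_derive_expR _) (is_derive_scale c s)) _.
by ring.
Qed.

(** The Schwarzian equation with a constant right-hand side, for each sign of
    the constant. *)
Lemma schwarzian_moebius_cos_sin c (I : set R) (p : R -> R) : 0 < c ->
  open I -> is_interval I ->
  (forall s, I s -> thrice_derivable p s /\ schwarzian p s = 2 * c ^+ 2) <->
  moebius_of (fun s => cos (c * s)) (fun s => sin (c * s)) I p.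
Proof.
move=> c0 oI itvI.
have du1 s : is_derive s 1 (fun t => - c * sin (c * t)) (- (c ^+ 2 * cos (c * s))).
  apply: is_derive_eq (is_derive_cstM (- c) (is_derive_sin_scale c s)) _; ring.
have dv1 s : is_derive s 1 (fun t => c * cos (c * t)) (- (c ^+ 2 * sin (c * s))).
  apply: is_derive_eq (is_derive_cstM c (is_derive_cos_scale c s)) _; ring.
have wr s : cos (c * s) * (c * cos (c * s)) - - c * sin (c * s) * sin (c * s) = c.
  have := cos2Dsin2 (c * s); set C := cos _; set S := sin _ => e.
  have -> : C * (c * C) - - c * S * S = c * (C ^+ 2 + S ^+ 2) by ring.
  by rewrite e mulr1.
split=> [hp|hm].
  exact: (schwarzian_moebius (lt0r_neq0 c0) (is_derive_cos_scale c) du1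
    (is_derive_sin_scale c) dv1 wr itvI hp).
exact: (moebius_schwarzian (lt0r_neq0 c0) (is_derive_cos_scale c) du1
    (is_derive_sin_scale c) dv1 wr oI hm).
Qed.

Lemma schwarzian_moebius_expR c (I : set R) (p : R -> R) : 0 < c ->
  open I -> is_interval I ->
  (forall s, I s -> thrice_derivable p s /\ schwarzian p s = 2 * - c ^+ 2) <->
  moebius_of (fun s => expR (c * s)) (fun s => expR (- c * s)) I p.
Proof.
move=> c0 oI itvI.
have du1 s : is_derive s 1 (fun t => c * expR (c * t))
    (- (- c ^+ 2 * expR (c * s))).
  apply: is_derive_eq (is_derive_cstM c (is_derive_expR_scale c s)) _; ring.
have dv1 s : is_derive s 1 (fun t => - c * expR (- c * t))
    (- (- c ^+ 2 * expR (- c * s))).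
  apply: is_derive_eq (is_derive_cstM (- c) (is_derive_expR_scale (- c) s)) _; ring.
have wr s : expR (c * s) * (- c * expR (- c * s))
    - c * expR (c * s) * expR (- c * s) = - 2 * c.
  have := expRxMexpNx_1 (c * s); rewrite -mulNr.
  set C := expR (c * s); set S := expR _ => e.
  have -> : C * (- c * S) - c * C * S = - 2 * c * (C * S) by ring.
  by rewrite e mulr1.
have om0 : - 2 * c != 0 by rewrite mulf_neq0 ?oppr_eq0 ?pnatr_eq0 ?gt_eqF.
split=> [hp|hm].
  exact: (schwarzian_moebius om0 (is_derive_expR_scale c) du1
    (is_derive_expR_scale (- c)) dv1 wr itvI hp).
exact: (moebius_schwarzian om0 (is_derive_expR_scale c) du1
    (is_derive_expR_scale (- c)) dv1 wr oI hm).
Qed.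

Lemma schwarzian_moebius_affine (I : set R) (p : R -> R) :
  open I -> is_interval I ->
  (forall s, I s -> thrice_derivable p s /\ schwarzian p s = 2 * 0) <->
  moebius_of (fun=> 1) (fun s => s) I p.
Proof.
move=> oI itvI.
have du s : is_derive s 1 (fun=> 1 : R) (0 : R) by exact: is_derive_cst.
have du1 s : is_derive s 1 (fun=> 0 : R) (- (0 * 1) : R).
  by rewrite mul0r oppr0; exact: is_derive_cst.
have dv s : is_derive s 1 (fun t : R => t) (1 : R) by exact: is_derive_id.
have dv1 s : is_derive s 1 (fun=> 1 : R) (- (0 * s) : R).
  by rewrite mul0r oppr0; exact: is_derive_cst.
have wr s : 1 * 1 - 0 * s = 1 :> R by ring.
split=> [hp|hm].
  exact: (schwarzian_moebius (oner_neq0 R) du du1 dv dv1 wr itvI hp).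
exact: (moebius_schwarzian (oner_neq0 R) du du1 dv dv1 wr oI hm).
Qed.

End ConcreteSolutions.

(** * Charts and geodesics *)

Section Charts.
Context {R : realType} {n : nat} {M : topologicalType}.
Context {A : smooth_atlas R n M} (F : finsler A).
Local Notation TR := ('rV[R]_n * 'rV[R]_n)%type.
Implicit Types (a c : chart A) (s t : R) (x : R -> M).

Lemma finsler_chart a : finsler_on (slit a) (F a).
Proof.
split.
- have -> : slit a = (fun z : TR => z.1) @^-1` (crd a @` dom a)
                     `&` (fun z : TR => z.2) @^-1` [set~ 0].
    by apply/seteqP; split=> z /= [h1 h2]; split=> //; exact/eqP.
  apply: openI; apply: open_comp => [z _|].
  + exact: cvg_fst.
  + exact: crd_open.
  + exact: cvg_snd.
  + by rewrite openC; exact: accessible_closed_set1 (hausdorff_accessible (@norm_hausdorff _ _)) _.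
- exact: finsler_smooth.
- by move=> z [].
- by move=> z l l0 [Dz z0]; split=> //=; rewrite scaler_eq0 negb_or gt_eqF.
- move=> z l l0 [[p ap pz] z0].
  rewrite -pz (finsler_homogeneous F _ ap l0) pz.
  by rewrite -surjective_pairing.
- exact: finsler_posdef.
Qed.

(** By homogeneity the norm vanishes on the zero section. *)
Lemma unit_vector_neq0 a p (y : 'rV[R]_n) : dom a p -> F a (crd a p, y) = 1 -> y != 0.
Proof.
move=> ap F1; apply/eqP => y0; move: F1; rewrite y0 => F1.
have := finsler_homogeneous F 0 ap (ltr0Sn R 1); rewrite scaler0 F1.
by lra.
Qed.

(** ** Invariance of the Ricci curvature under the transition maps *)

Section Transition.
Context (a c : chart A).

Let D : set 'rV[R]_n := crd a @` (dom a `&` dom c).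
Let phi : 'rV[R]_n -> 'rV[R]_n := crd c \o Defs.inv a.
Let psi : 'rV[R]_n -> 'rV[R]_n := crd a \o Defs.inv c.
Let W : set TR := [set z | D z.1 /\ z.2 != 0].

Let phiE p : dom a p -> phi (crd a p) = crd c p.
Proof. by move=> ap; rewrite /phi /= crdK. Qed.

Let open_overlap (a' c' : chart A) : open (crd a' @` (dom a' `&` dom c')).
Proof.
rewrite openE => _ [p [ap cp] <-].
have n1 : nbhs (crd a' p) (crd a' @` dom a').
  by apply: open_nbhs_nbhs; split; [exact: crd_open|exists p].
have n2 : nbhs (crd a' p) (Defs.inv a' @^-1` dom c').
  apply: (Defs.inv_continuous ap); rewrite crdK//.
  by apply: open_nbhs_nbhs; split; [exact: dom_open|].
apply: filterS (filterI n1 n2) => u [[r ar <-]] /=.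
by rewrite crdK// => cr; exists r.
Qed.

Let oD : open D. Proof. exact: open_overlap. Qed.

Let sphi : smooth_on D phi. Proof. exact: transition_smooth. Qed.

Let psiK u : D u -> psi (phi u) = u.
Proof. by move=> [p [ap cp] <-]; rewrite phiE// /psi /= crdK. Qed.

Let oW : open W.
Proof.
have -> : W = (fun z : TR => z.1) @^-1` D `&` slit a.
  apply/seteqP; split=> z /= [].
    by move=> Dz z0; split=> //; split=> //; case: Dz => p [ap _] <-; exists p.
  by move=> Dz [_ z0].
apply: openI; last exact: fo_open (finsler_chart a).
by apply: open_comp => [z _|]; [exact: cvg_fst|exact: oD].
Qed.

(* the inverse transition map provides a left inverse of the Jacobian *)
Let derive_phi_inj u (y : 'rV[R]_n) : D u -> 'D_y phi u = 0 -> y = 0.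
Proof.
move=> Du; have dphi : differentiable phi u by exact: smooth_diff sphi Du.
have dpsi : differentiable psi (phi u).
  apply: (smooth_diff (@transition_smooth _ _ _ A c a)).
  by case: Du => p [ap cp] <-; rewrite phiE//; exists p.
move=> y0; rewrite -(derive_id u y).
have e : 'D_y (psi \o phi) u = 'D_y id u.
  by apply: der_eq_on oD _ Du => w Dw; exact: psiK.
rewrite -e deriveE; last exact: differentiable_comp.
refine (etrans (congr1 (fun h => h y) (diff_comp dphi dpsi)) _).
refine (etrans (congr1 ('d psi (phi u)) (_ : 'd phi u y = 0)) (linear0 _)).
exact: etrans (esym (deriveE y dphi)) y0.
Qed.

Let jac_unit z : W z -> (\matrix_(m, k) jac phi m k z) \in unitmx.
Proof.
move=> [Dz _]; rewrite -unitmx_tr -row_free_unit -kermx_eq0.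
apply/eqP/row_matrixP => i; rewrite row0.
have ker0 (v : 'rV[R]_n) : v *m (\matrix_(m, k) jac phi m k z)^T = 0 -> v = 0.
  move=> v0; apply: (derive_phi_inj Dz).
  have /(congr1 snd) := tangent_mapE oD sphi (z := (z.1, v)) Dz => /= <-.
  apply/rowP => m; rewrite mxE; move/rowP/(_ m): v0; rewrite mxE [RHS]mxE => v0.
  rewrite [RHS]mxE -[RHS]v0; apply: eq_bigr => k _; rewrite mulrC mxE mxE //.
by apply: ker0; apply/sub_kermxP; exact: row_sub.
Qed.

Let WD : W `<=` [set z | D z.1]. Proof. by move=> z []. Qed.

Let Wslit : W `<=` slit a.
Proof. by move=> z [[p [ap _] pz] z0]; split=> //; exists p. Qed.

Let tangent_map_slit z : W z -> slit c (tangent_map phi z).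
Proof.
move=> Wz; have [Dz z0] := Wz; rewrite (tangent_mapE oD sphi (WD Wz)); split=> /=.
  by case: Dz => p [ap cp] <-; rewrite phiE//; exists p.
by apply: contraNN z0 => /eqP /(derive_phi_inj Dz) ->.
Qed.

Let norm_tangent_map z : W z -> F a z = F c (tangent_map phi z).
Proof.
move=> Wz; rewrite (tangent_mapE oD sphi (WD Wz)); case: (Wz) => -[p [ap cp] pz] _.
by rewrite -pz phiE// finsler_glue// pz -surjective_pairing.
Qed.

(** The velocity of a curve in two charts. *)
Lemma lift_tangent_map x s : dom a (x s) -> dom c (x s) ->
  {for s, continuous x} -> derivable (crd a \o x) s 1 ->
  Defs.lift x c s = tangent_map phi (Defs.lift x a s).
Proof.
move=> ap cp cx dx.
have Du : D (crd a (x s)) by exists (x s).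
rewrite (tangent_mapE (z := Defs.lift x a s) oD sphi Du) /Defs.lift /= phiE//; congr pair.
have near_s : \forall t \near s, (phi \o (crd a \o x)) t = (crd c \o x) t.
  have : nbhs (x s) (dom a) by apply: open_nbhs_nbhs; split=> //; exact: dom_open.
  move=> nd; have nx : \forall t \near s, dom a (x t) by exact: cx.
  by apply: filterS nx => t; exact: phiE.
rewrite derive1E -(near_eq_derive _ near_s).
have df := (derivable1_diffP _ _).1 dx.
have dphi : differentiable phi ((crd a \o x) s) by exact: smooth_diff sphi Du.
refine (etrans (deriveE _ (differentiable_comp df dphi)) _).
refine (etrans (congr1 (fun h => h 1) (diff_comp df dphi)) _).
refine (etrans (esym (deriveE _ dphi)) _).
refine (congr1 (fun v => 'D_v phi _) _).
by refine (etrans (esym (deriveE _ df)) _); rewrite derive1E.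
Qed.

(** The Ricci curvature along a curve does not depend on the chart. *)
Lemma ricci_along_chart x s : dom a (x s) -> dom c (x s) ->
  {for s, continuous x} -> derivable (crd a \o x) s 1 ->
  (Defs.lift x a s).2 != 0 ->
  ricci_along F x c s = ricci_along F x a s.
Proof.
move=> ap cp cx dx l0.
rewrite /ricci_along (lift_tangent_map ap cp cx dx).
apply: (ricci_quadratic_Phi oD sphi (finsler_chart a) (finsler_chart c) oW
  Wslit WD tangent_map_slit norm_tangent_map jac_unit).
by split=> //; exists (x s).
Qed.

End Transition.

(** The three parallelism hypotheses share the following consequence, in which
    [C] stands for the Chern or the Berwald coefficients. *)
Lemma parallel_contract a z :
  [\/ cartan_parallel F, berwald_parallel F | chern_parallel F] -> slit a z ->
  exists C, (forall i, \sum_j \sum_k C i j k z * z.2 0 j * z.2 0 k = spray (F a) i z)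
    /\ forall i j k, ricci_hderiv (F a) C i j k z = 0.
Proof.
move=> parF az; have Fa := finsler_chart a.
case: parF => par.
- exists (chern_coef (F a)); split=> [i|i j k]; first exact (chern_contract Fa i az).
  by have [] := par a z az i j k.
- exists (berwald_coef (F a)); split=> [i|i j k].
    exact (berwald_contract Fa i az).
  by have [] := par a z az i j k.
- exists (chern_coef (F a)); split=> [i|i j k]; first exact (chern_contract Fa i az).
  by have [] := par a z az i j k.
Qed.

(** If the Ricci tensor is parallel, its value on the unit tangent vectors of a
    geodesic is constant. *)
Lemma ricci_along_constant (J : set R) x :
  [\/ cartan_parallel F, berwald_parallel F | chern_parallel F] ->
  open J -> is_interval J -> geodesic F J x ->
  exists K : R, forall s a, J s -> dom a (x s) -> ricci_along F x a s = K.
Proof.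
move=> parF oJ itvJ geo.
have [[s0 Js0]|J0] := pselect (J !=set0); last first.
  by exists 0 => s a Js; exfalso; apply: J0; exists s.
have lift_neq0 s a : J s -> dom a (x s) -> (Defs.lift x a s).2 != 0.
  move=> Js as_; have [_ /(_ a as_)[_ _ F1 _]] := geo s Js.
  exact: unit_vector_neq0 as_ F1.
have indep s a c : J s -> dom a (x s) -> dom c (x s) ->
    ricci_along F x c s = ricci_along F x a s.
  move=> Js as_ cs; have [cx /(_ a as_)[dx _ _ _]] := geo s Js.
  by apply: ricci_along_chart => //; exact: lift_neq0.
have derive0 s a : J s -> dom a (x s) -> is_derive s 1 (ricci_along F x a) 0.
  move=> Js as_; have [_ /(_ a as_)[dx ddx _ eqn]] := geo s Js.
  have az : slit a (Defs.lift x a s).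
    by split; [exists (x s)|exact: lift_neq0].
  have [C [CG par]] := parallel_contract parF az.
  exact: (ricci_along_geodesic_derive (finsler_chart a) az dx ddx eqn CG par).
(* near each parameter value the curve is read in one fixed chart *)
pose ch s := projT1 (cid (dom_cover A (x s))).
have chP s : dom (ch s) (x s) by exact: projT2 (cid (dom_cover A (x s))).
pose f s := ricci_along F x (ch s) s.
have df s : J s -> is_derive s 1 f 0.
  move=> Js; apply: near_eq_is_derive (derive0 s (ch s) Js (chP s)).
  have nJ : \forall t \near s, J t by exact: open_nbhs_nbhs.
  have nd : \forall t \near s, dom (ch s) (x t).
    have [cx _] := geo s Js.
    have nd : nbhs (x s) (dom (ch s)).
      by apply: open_nbhs_nbhs; split; [exact: dom_open|].
    exact: cx.
  by near=> t; apply: indep => //; near: t.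
exists (f s0) => s a Js as_.
refine (etrans (indep s (ch s) a Js (chP s) as_) _).
exact (constant_on_interval itvJ df Js Js0).
Unshelve. all: by end_near. Qed.

End Charts.

Lemma projective_parameterE (R : realType) (n : nat) (M : topologicalType)
    (A : smooth_atlas R n M) (F : finsler A) (x : R -> M) (I : set R)
    (p : R -> R) (K : R) :
  (forall s a, I s -> dom a (x s) -> ricci_along F x a s = K) ->
  projective_parameter F x I p <->
  (forall s, I s -> thrice_derivable p s /\
     schwarzian p s = 2 / (n%:R - 1) * K).
Proof.
move=> ricK; split=> hp s Is.
  have [d1 d2 d3 p0 sch] := hp s Is; split=> //.
  have [a as_] := dom_cover A (x s).
  by rewrite (sch a as_) (ricK s a Is as_).
have [[d1 d2 d3 p0] sch] := hp s Is; split=> // a as_.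
by rewrite sch (ricK s a Is as_).
Qed.

Theorem theorem1 (R : realType) (n : nat) (M : topologicalType)
    (A : smooth_atlas R n M) (F : finsler A)
    (hausM : hausdorff_space M) (scM : @second_countable M)
    (connM : connected [set: M])
    (parF : [\/ cartan_parallel F, berwald_parallel F | chern_parallel F])
    (J : set R) (x : R -> M) (openJ : open J) (itvJ : is_interval J)
    (geoX : geodesic F J x) :
  exists K : R,
    (forall s a, J s -> dom a (x s) -> ricci_along F x a s = K) /\
    ((1 < n)%N ->
     forall (I : set R) (p : R -> R), open I -> is_interval I -> I `<=` J ->
     [/\ forall c : R, 0 < c -> 2 / (n%:R - 1) * K = 2 * c ^+ 2 ->
           (projective_parameter F x I p <->
            moebius_of (fun s => cos (c * s)) (fun s => sin (c * s)) I p),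
         forall c : R, 0 < c -> 2 / (n%:R - 1) * K = - (2 * c ^+ 2) ->
           (projective_parameter F x I p <->
            moebius_of (fun s => expR (c * s)) (fun s => expR (- c * s)) I p) &
         2 / (n%:R - 1) * K = 0 ->
           (projective_parameter F x I p <->
            moebius_of (fun=> 1) (fun s => s) I p)]).
Proof.
have [K ricK] := ricci_along_constant parF openJ itvJ geoX.
exists K; split=> // _ I p oI itvI IJ.
have projE := projective_parameterE p (fun s a Is => ricK s a (IJ s Is)).
split=> [c c0 e|c c0 e|e]; apply: iff_trans projE _; rewrite e.
- exact: schwarzian_moebius_cos_sin.
- by rewrite -mulrN; exact: schwarzian_moebius_expR.
- by rewrite -(mulr0 2); exact: schwarzian_moebius_affine.
Qed.
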